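(* Let $d\ge 1$, $x_0\in\mathbb{R}^d$, and let $f\in C^0([0,1]\times\mathbb{R}^d,\mathbb{R}^d)$ be such that for some $k\ge 0$, $|f(t,x)-f(t,y)|\le k|x-y|$ for all $t\in[0,1]$ and $x,y\in\mathbb{R}^d$. Let $j\in C^0([0,1]\times\mathbb{R}^d)$, $h\in C^0(\mathbb{R}^d)$ and $g\in C^0(T)$ be real-valued, and set $$J(\gamma):=\int_0^1 j(t,x_\gamma(t))\,dt+h(x_\gamma(1))+\int_T g(t,s)\,d\gamma(t,s),\qquad \gamma\in\Gamma.$$ Let $\Theta$ be the set of Borel maps $\theta:[0,1]\to[0,1]$ with $\theta(t)\le t$ for a.e. $t\in[0,1]$, and let $F(\theta):=J(\delta_\theta\otimes\mathcal{L}^1)$ for $\theta\in\Theta$. Then for every $\gamma\in\Gamma$ there exists a sequence $(\theta_n)$ in $\Theta$ such that $F(\theta_n)\to J(\gamma)$. In particular, $$\min_{\gamma\in\Gamma}J(\gamma)=\inf_{\theta\in\Theta}F(\theta)$$ (with the minimum on the left attained).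
   Context: $\mathcal{L}^1$ is the Lebesgue measure on $[0,1]$ and $T:=\{(t,s)\in[0,1]^2 : s\le t\}$. $\Gamma$ is the set of Borel probability measures $\gamma$ on $[0,1]^2$ with $\gamma(T)=1$ and first marginal ${\pi_1}_\#\gamma=\mathcal{L}^1$. Every $\gamma\in\Gamma$ disintegrates as $\gamma=\nu_t\otimes\mathcal{L}^1$, meaning $\int\varphi\,d\gamma=\int_0^1\big(\int_0^1\varphi(t,s)\,d\nu_t(s)\big)dt$ for all $\varphi\in C^0([0,1]^2)$, where $(\nu_t)_{t\in[0,1]}$ is a Borel family of probability measures on $[0,1]$ ($t\mapsto\int \phi\,d\nu_t$ is Borel for every continuous $\phi$) with $\nu_t([0,t])=1$ for every $t$. For $\gamma=\nu_t\otimes\mathcal{L}^1\in\Gamma$, $x_\gamma\in C^0([0,1],\mathbb{R}^d)$ denotes the unique continuous solution of $\dot x(t)=\int_0^t f(s,x(s))\,d\nu_t(s)$, $x(0)=x_0$, understood in the integrated form $x(t)=x_0+\int_0^t\big(\int_0^\tau f(s,x(s))\,d\nu_\tau(s)\big)d\tau$ for all $t\in[0,1]$. For $\theta\in\Theta$, $\delta_\theta\otimes\mathcal{L}^1\in\Gamma$ is the measure defined by $\int\varphi\,d(\delta_\theta\otimes\mathcal{L}^1)=\int_0^1\varphi(t,\theta(t))\,dt$. *)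

(* Defs.v *)
From HB Require Import structures.
From mathcomp Require Import all_boot all_order all_algebra.
From mathcomp Require Import all_classical all_reals all_analysis.
From mathcomp Require Import measurable_realfun.

Set Implicit Arguments.
Unset Strict Implicit.
Unset Printing Implicit Defensive.

Import Order.TTheory GRing.Theory Num.Theory.
Import numFieldNormedType.Exports.

Local Open Scope classical_set_scope.
Local Open Scope ring_scope.

Definition I01 {R : realType} : set R := `[0, 1]%classic.

Definition triangle {R : realType} : set (R * R) :=
  (I01 `*` I01) `&` [set p | p.2 <= p.1].

(* The norm of the library on ['rV[R]_d] is the sup norm. *)
Definition norm2 {R : realType} {d : nat} (v : 'rV[R]_d) : R :=
  Num.sqrt (\sum_(i < d) (v 0 i) ^+ 2).

(* Borel probability measures on [0,1] and [0,1]^2 are represented by Borel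
   probability measures on R and R^2 that give these sets full mass; the
   product sigma-algebra on [R * R] is the Borel one ([open_measurable2]). *)
Definition Gamma {R : realType} : set (probability (R * R)%type R) :=
  [set gamma | gamma triangle = 1%E /\
    forall A : set R, measurable A ->
      pushforward gamma fst A = lebesgue_measure (A `&` I01)].

Section dynamics.
Context {R : realType}.
Local Notation leb := (@lebesgue_measure R).

Definition disintegration (gamma : probability (R * R)%type R)
    (nu : R -> probability R R) : Prop :=
  [/\ forall t, I01 t -> nu t `[0, t]%classic = 1%E,
      forall phi : R -> R, {within I01, continuous phi} ->
        measurable_fun (I01 : set R) (fun t => \int[nu t]_(s in I01) phi s) &
      forall phi : R * R -> R, {within I01 `*` I01, continuous phi} ->
        \int[gamma]_(p in I01 `*` I01) phi p =
        \int[leb]_(t in I01) (\int[nu t]_(s in I01) phi (t, s))].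

Context {d : nat}.

Definition solution (x0 : 'rV[R]_d) (f : R -> 'rV[R]_d -> 'rV[R]_d)
    (nu : R -> probability R R) (x : R -> 'rV[R]_d) : Prop :=
  {within I01, continuous x} /\
  forall t, I01 t -> forall i : 'I_d,
    x t 0 i = x0 0 i +
      \int[leb]_(tau in `[0, t]) (\int[nu tau]_(s in `[0, tau]) f s (x s) 0 i).

(* [traj x0 f gamma] is unique only on [0,1], the only place where it is used;
   it does not depend on the choice of the disintegration. *)
Definition traj (x0 : 'rV[R]_d) (f : R -> 'rV[R]_d -> 'rV[R]_d)
    (gamma : probability (R * R)%type R) : R -> 'rV[R]_d :=
  xget (cst x0) [set x | exists2 nu, disintegration gamma nu &
                                     solution x0 f nu x].

Definition J (x0 : 'rV[R]_d) (f : R -> 'rV[R]_d -> 'rV[R]_d)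
    (j : R -> 'rV[R]_d -> R) (h : 'rV[R]_d -> R) (g : R -> R -> R)
    (gamma : probability (R * R)%type R) : R :=
  (\int[leb]_(t in I01) j t (traj x0 f gamma t))
  + h (traj x0 f gamma 1)
  + (\int[gamma]_(p in triangle) g p.1 p.2).

End dynamics.

Section measurability.
Context {R : realType}.

Lemma measurable_I01 : measurable (I01 : set R).
Proof. exact: measurable_itv. Qed.

Lemma measurable_triangle : measurable (triangle : set (R * R)).
Proof.
apply: measurable_fun_le.
- exact: measurableX measurable_I01 measurable_I01.
- exact: measurable_funTS measurable_snd.
- exact: measurable_funTS measurable_fst.
Qed.

Lemma open_measurable2 (O : set (R * R)) : open O -> measurable O.
Proof.
move=> oO.
pose box (i : rat * rat * rat) : set (R * R) :=
  ball (ratr i.1.1 : R) (ratr i.2) `*` ball (ratr i.1.2 : R) (ratr i.2).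
have mbox i : measurable (box i).
  by apply: measurableX; apply: open_measurable; exact: ball_open.
have -> : O = \bigcup_i (if pselect (box i `<=` O) then box i else set0).
  apply/seteqP; split => [[x y] Oxy|p [i _]]; last first.
    by case: pselect => [sub|//]; exact: sub.
  have [e /= e0 eO] : exists2 e : R, 0 < e & ball (x, y) e `<=` O.
    by apply/nbhs_ballP; exact: open_nbhs_nbhs.
  have /rat_in_itvoo[r] : 0 < e / 2 by rewrite divr_gt0.
  rewrite in_itv/= => /andP[r0 re].
  have xlt : x < x + ratr r by rewrite ltrDl.
  have ylt : y < y + ratr r by rewrite ltrDl.
  have [q1 /[!in_itv]/= /andP[q1x xq1]] := rat_in_itvoo xlt.
  have [q2 /[!in_itv]/= /andP[q2y yq2]] := rat_in_itvoo ylt.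
  have bxq : ball (ratr q1 : R) (ratr r) x.
    by rewrite /ball/= gtr0_norm ?subr_gt0// ltrBlDl.
  have byq : ball (ratr q2 : R) (ratr r) y.
    by rewrite /ball/= gtr0_norm ?subr_gt0// ltrBlDl.
  exists (q1, q2, r) => //; case: pselect => [_ //|]; case.
  have er : ratr r + ratr r <= e by rewrite [leRHS]splitr lerD// ltW.
  by move=> [u v] [/= bu bv]; apply: eO; split => /=;
    apply: (le_ball er); [apply: ball_triangle bu|apply: ball_triangle bv];
    exact: ball_sym.
apply: countable_bigcupT_measurable => [|i]; first exact: countableP.
by case: pselect => h /=; [exact: mbox|exact: measurable0].
Qed.

Lemma measurable_within2 (phi : R * R -> R) :
  {within I01 `*` I01, continuous phi} -> measurable_fun (I01 `*` I01) phi.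
Proof.
move=> /continuousP cphi; apply: (measurability _ (RGenOpens.measurableE R)).
move=> _ [_ [a [b ->] <-]].
have oab : open (`]a, b[%classic : set R) by exact: interval_open.
have /cphi/open_subspaceP[V oV VD] := oab.
rewrite setIC -VD; apply: measurableI; first exact: open_measurable2.
exact: measurableX measurable_I01 measurable_I01.
Qed.

End measurability.

Record Theta (R : realType) := MkTheta {
  theta_fun :> R -> R ;
  theta_measurable : measurable_fun (I01 : set R) theta_fun ;
  theta_I01 : forall t, I01 t -> I01 (theta_fun t) ;
  theta_le : {ae @lebesgue_measure R, forall t, I01 t -> theta_fun t <= t} }.

Section delta.
Context {R : realType} (theta : Theta R).
Local Notation leb := (@lebesgue_measure R).

Let graph (t : R) : R * R := (t, theta t).

(* $\delta_\theta \otimes \mathcal L^1$ is the image of the Lebesgue measure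
   on [0,1] by the graph of [theta]; see [integral_delta]. *)
Definition delta : set (R * R) -> \bar R :=
  pushforward (mrestr leb measurable_I01) graph.

Let graph0 (t : R) : R * R := (t, (theta \_ I01) t).

Let measurable_graph0 : measurable_fun [set: R] graph0.
Proof.
apply: measurable_fun_pair; first exact: measurable_id.
have mI : measurable (I01 : set R) := measurable_I01.
exact: (proj1 (measurable_restrictT (theta : R -> R) mI)
             (theta_measurable theta)).
Qed.

Let deltaE : delta = pushforward (mrestr leb measurable_I01) graph0.
Proof.
apply/funext => A; rewrite /delta /pushforward /mrestr; congr (leb _).
rewrite /graph /graph0; apply/seteqP; split => t /= [At It];
  by split => //; move: At; rewrite patchE mem_set.
Qed.

Let mgraph (A : set (R * R)) : measurable A -> measurable (graph0 @^-1` A).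
Proof.
by move=> mA; rewrite -[X in measurable X]setTI; exact: measurable_graph0.
Qed.

Let delta0 : delta set0 = 0%E.
Proof. by rewrite /delta /pushforward preimage_set0 measure0. Qed.

Let delta_ge0 A : (0 <= delta A)%E.
Proof. by rewrite /delta /pushforward measure_ge0. Qed.

Let delta_sigma_additive : semi_sigma_additive delta.
Proof.
rewrite deltaE => F mF tF mUF; rewrite /pushforward preimage_bigcup.
apply: measure_semi_sigma_additive.
- by move=> n; exact: mgraph.
- apply/trivIsetP => /= i j _ _ ij; rewrite -preimage_setI.
  by move/trivIsetP : tF => /(_ _ _ _ _ ij) ->//; rewrite preimage_set0.
- by rewrite -preimage_bigcup; exact: mgraph.
Qed.

HB.instance Definition _ := isMeasure.Build _ _ _ delta
  delta0 delta_ge0 delta_sigma_additive.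

Let deltaT : delta setT = 1%E.
Proof.
rewrite /delta /pushforward preimage_setT /mrestr setTI /I01.
by rewrite lebesgue_measure_itv/= lte_fin ltr01 oppr0 adde0.
Qed.

HB.instance Definition _ := Measure_isProbability.Build _ _ _ delta deltaT.

Lemma Gamma_delta : Gamma (delta : probability (R * R)%type R).
Proof.
have leb1 : leb I01 = 1%E.
  by rewrite lebesgue_measure_itv/= lte_fin ltr01 oppr0 adde0.
split => /=; last by move=> A mA.
rewrite deltaE /pushforward /mrestr -leb1.
have mG := mgraph measurable_triangle.
have mI : measurable (I01 : set R) := measurable_I01.
have [N [mN N0 HN]] := theta_le theta.
apply/eqP; rewrite eq_le; apply/andP; split.
  by apply: le_measure; rewrite ?inE//; exact: measurableI.
rewrite -[leRHS]adde0 -N0; apply: le_trans (measureU2 _ _ _); last 2 first.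
- exact: measurableI.
- exact: mN.
apply: le_measure; rewrite ?inE//.
  by apply: measurableU => //; exact: measurableI.
move=> t It; have [Nt|Nt] := pselect (N t); [by right|left; split => //].
have le_t : theta t <= t.
  by apply: contrapT => le_t; apply: Nt; apply: HN => /= /(_ It).
by rewrite /graph0 /= patchE mem_set//; do 2?split => //; exact: theta_I01.
Qed.

Let ge0_integral_delta (F : R * R -> \bar R) :
  measurable_fun setT F -> (forall p, 0 <= F p)%E ->
  (\int[delta]_p F p = \int[leb]_(t in I01) F (graph0 t))%E.
Proof.
move=> mF F0.
have mFg : measurable_fun setT (F \o graph0).
  exact: measurableT_comp measurable_graph0.
transitivity (\int[pushforward (mrestr leb measurable_I01) graph0]_p F p)%E.
  by apply: eq_measure_integral => A _ _ /=; rewrite deltaE.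
rewrite ge0_integral_pushforward//= preimage_setT.
rewrite (eq_measure_integral (uniform_prob (@ltr01 R))) => [|A mA _].
  by rewrite integral_uniform// subr0 invr1 mul1e.
rewrite /= /mrestr /uniform_prob integral_uniform_pdf.
rewrite (eq_integral (cst 1%E)) => [|t].
  by rewrite integral_cst ?mul1e//; exact: measurableI.
by rewrite inE/= in_itv/= => -[_ It]; rewrite /uniform_pdf It subr0 invr1.
Qed.

Lemma integral_delta (phi : R * R -> R) :
  {within I01 `*` I01, continuous phi} ->
  \int[delta]_(p in I01 `*` I01) phi p = \int[leb]_(t in I01) phi (t, theta t).
Proof.
move=> cphi; rewrite /Rintegral; congr fine.
have mII : measurable (I01 `*` I01 : set (R * R)).
  exact: measurableX measurable_I01 measurable_I01.
rewrite integral_mkcond; set F := _ \_ _.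
have mF : measurable_fun setT F.
  have mphi : measurable_fun (I01 `*` I01) (EFin \o phi).
    by apply/measurable_EFinP; exact: measurable_within2.
  exact: (proj1 (measurable_restrictT (EFin \o phi) mII) mphi).
rewrite integralE !ge0_integral_delta//; last 2 first.
  exact: measurable_funeneg.
  exact: measurable_funepos.
transitivity (\int[leb]_(t in I01) F (graph0 t))%E.
  rewrite [RHS]integralE; congr (_ - _)%E;
    by apply: eq_integral => t _; rewrite ?funeposE ?funenegE.
apply: eq_integral => t tI; rewrite /F /graph0 !patchE tI mem_set//.
by split; [exact/set_mem|exact/theta_I01/set_mem].
Qed.

End delta.

Definition F {R : realType} {d : nat} (x0 : 'rV[R]_d)
    (f : R -> 'rV[R]_d -> 'rV[R]_d) (j : R -> 'rV[R]_d -> R)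
    (h : 'rV[R]_d -> R) (g : R -> R -> R) (theta : Theta R) : R :=
  J x0 f j h g (delta theta).

(* Main.v *)
Require Import Defs.
From HB Require Import structures.
From mathcomp Require Import all_boot all_order all_algebra.
From mathcomp Require Import all_classical all_reals all_analysis.
From mathcomp Require Import measurable_realfun ring lra.

(** Testing a disintegration against a cutoff in [t] shows that the trajectory
    of [gamma] solves an integral equation that only involves [gamma]:
    [x t = x0 + \int[gamma] 1_(tau <= t) f (s, x s)].  As [s <= tau] on the
    triangle, the weight [expR (2 K t)] makes it a contraction, which gives
    existence, and stability of [x], hence continuity of [J], under convergence
    of [\int[gamma] 1_(tau <= t) psi s] for all [t] and continuous [psi].

    Density: cut [0, 1] into slabs and let [theta] be, on each slab, the
    quantile function of the second marginal of [gamma] restricted to the slab.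
    Because [gamma] lives on [s <= t], this increasing rearrangement stays below
    the diagonal, and [delta theta] has the same second marginal as [gamma] on
    each slab.

    Compactness: along an ultrafilter the numbers
    [gamma_n (A * ]-oo, q])] converge for every [A] and rational [q]; in [A]
    the limit is additive and dominated by the Lebesgue measure, hence a measure
    with a density [G q], monotone in [q].  Inverting [q |-> G q t] in the
    quantile variable [u] gives [Q (t, u)], and the law of [(t, Q (t, u))] for
    uniform [t], [u] is a limit of [gamma_n] in [Gamma], disintegrated by the
    laws of [Q (t, .)].  For a constant sequence this is the existence of
    disintegrations; for a minimizing sequence it gives the minimizer. *)

Set Implicit Arguments.
Unset Strict Implicit.
Unset Printing Implicit Defensive.

Import Order.TTheory GRing.Theory Num.Theory.
Import numFieldNormedType.Exports.

Local Open Scope classical_set_scope.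
Local Open Scope ring_scope.

(** * Bounded integrands and the triangle *)

(** Two test functions resist plain weak convergence: the cutoff tau <= t, discontinuous in tau, and
    the indicator s <= q, discontinuous in s. The first is harmless because every measure of [Gamma]
    gives the slab a < tau <= b the mass b - a: integrals of a fixed bounded function over [tri t]
    are Lipschitz in t, uniformly in the measure. The second fails at atoms, so limits of
    distribution functions are never identified with those of the limit measure; they are only
    trapped between its values at neighbouring rational levels, which is enough for continuous
    integrands. An ultrafilter replaces extraction of subsequences because the limit must exist for
    every Borel set A at once before it can be differentiated with respect to the Lebesgue measure.
    Density and compactness share one quantile construction. Its infimum is capped at t, which
    forces the values below the diagonal for every t, and since the given measures live on s <= tau
    the cap leaves the prescribed law intact. Existence of disintegrations comes out of the
    compactness argument, hence last; until then the results on trajectories assume it. *)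

Section bounded_integrands.
Context d (T : measurableType d) (R : realType).
Variable mu : {measure set T -> \bar R}.
Implicit Types (D : set T) (f : T -> R).

Lemma integrable_bdd D f (M : R) : measurable D -> (mu D < +oo)%E ->
  measurable_fun D f -> (forall x, D x -> `|f x| <= M) ->
  mu.-integrable D (EFin \o f).
Proof.
move=> mD Dfin mf fM; apply: measurable_bounded_integrable => //.
exists M; split; first exact: num_real.
by move=> r Mr x Dx; apply: le_trans (fM _ Dx) (ltW Mr).
Qed.

Lemma Rintegral_bdd D f (M : R) : measurable D -> (mu D < +oo)%E ->
  measurable_fun D f -> (forall x, D x -> `|f x| <= M) ->
  `|\int[mu]_(x in D) f x| <= M * fine (mu D).
Proof.
move=> mD Dfin mf fM; have fi := integrable_bdd mD Dfin mf fM.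
apply: le_trans (le_normr_Rintegral mD fi) _.
rewrite -Rintegral_cst//; apply: le_Rintegral => //.
  exact: (integrable_norm fi).
apply: (@integrable_bdd _ _ `|M|) => //; exact: measurable_cst.
Qed.

Lemma Rintegral_dist D f g (M : R) : measurable D -> (mu D < +oo)%E ->
  mu.-integrable D (EFin \o f) -> mu.-integrable D (EFin \o g) ->
  (forall x, D x -> `|f x - g x| <= M) ->
  `|\int[mu]_(x in D) f x - \int[mu]_(x in D) g x| <= M * fine (mu D).
Proof.
move=> mD Dfin fi gi fM; rewrite -RintegralB//.
apply: Rintegral_bdd => //.
apply: measurable_funB; apply/measurable_EFinP;
  [exact: measurable_int fi|exact: measurable_int gi].
Qed.

Lemma Rintegral_setD A B f : measurable A -> measurable B -> A `<=` B ->
  mu.-integrable B (EFin \o f) ->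
  \int[mu]_(x in B) f x = \int[mu]_(x in A) f x + \int[mu]_(x in B `\` A) f x.
Proof.
move=> mA mB AB fi; rewrite -Rintegral_setU//.
- by rewrite setDUK.
- exact: measurableD.
- by rewrite setDUK.
- by apply/disj_setPS => x [Ax [_]].
Qed.

End bounded_integrands.

(** The second point ranges over [D], not only over [K]: in [J_cvg], [K] is the graph of the limit
    trajectory, [D] is the non-compact product of [0,1] with the state space, and the perturbed
    trajectories leave [K]. *)
Lemma compact_unif_cont (R : realType) (T : pseudoMetricType R) (D K : set T)
    (phi : T -> R) (e : R) :
  compact K -> K `<=` D -> {within D, continuous phi} -> 0 < e ->
  exists2 r : R, 0 < r & forall p q, K p -> D q -> ball p r q ->
    `|phi p - phi q| < e.
Proof.
move=> cK KD cphi e0.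
have /compact_near_coveringP/near_covering_withinP cov := cK.
have : \forall r \near 0^'+, K `<=`
    (fun p => forall q, D q -> ball p r q -> `|phi p - phi q| < e).
  apply: cov => x Kx.
  have e20 : 0 < e / 2 by rewrite divr_gt0.
  have /subspace_continuousP/(_ x (KD _ Kx))/cvgrPdist_lt/(_ _ e20) := cphi.
  rewrite near_withinE => /nbhs_ballP[/= s s0 xs].
  have s20 : 0 < s / 2 by rewrite divr_gt0.
  exists (ball x (s / 2), [set r | 0 < r < s / 2]) => /=.
    split; first exact: nbhsx_ballx.
    by apply: filterS2 (nbhs_right_gt (0 : R)) (nbhs_right_lt s20) => r r0 rs;
      apply/andP.
  move=> [p r]/= [xp /andP[r0 rs]] Kp q Dq pq.
  have xq : ball x s q.
    rewrite [s]splitr; apply: ball_triangle xp _.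
    by apply: le_ball pq; exact: ltW.
  have xp' : ball x s p by apply: le_ball xp; rewrite ler_pdivrMr// ler_peMr// ?ler1n// ltW.
  have h1 := xs _ xq Dq; have h2 := xs _ xp' (KD _ Kp).
  rewrite (_ : phi p - phi q = (phi x - phi q) - (phi x - phi p)); last by lra.
  by rewrite (le_lt_trans (ler_normB _ _))// [ltRHS]splitr ltrD.
move=> near0; have [r [r0 Hr]] : exists r, 0 < r /\ K `<=`
    (fun p => forall q, D q -> ball p r q -> `|phi p - phi q| < e).
  have := @filter_ex _ (0^'+ : set_system R) _ _
   (filterI (nbhs_right_gt (0:R)) near0).
  by case=> r [r0 Hr]; exists r.
by exists r => // p q Kp; exact: Hr.
Qed.

Lemma compact_bdd (R : realType) (T : pseudoMetricType R) (K : set T)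
    (phi : T -> R) :
  compact K -> {within K, continuous phi} ->
  exists2 M : R, 0 <= M & forall p, K p -> `|phi p| <= M.
Proof.
move=> cK cphi; have := continuous_compact cphi cK.
move=> /compact_bounded[M [_ HM]].
exists (`|M| + 1); first by rewrite addr_ge0.
move=> p Kp; apply: HM; last by exists p.
by rewrite ltr_pwDr// ler_norm.
Qed.

Section gamma.
Context {R : realType}.
Local Notation leb := (@lebesgue_measure R).

(** Integrating a function of s over this set yields the double integral of the equation of motion
    up to time t; see [disintegration_tri]. *)
Definition tri (t : R) : set (R * R) := triangle `&` [set p | p.1 <= t].

Lemma I01P (t : R) : I01 t <-> 0 <= t <= 1.
Proof. by rewrite /I01 /= in_itv. Qed.

Lemma compact_I01 : compact (I01 : set R).
Proof. exact: segment_compact. Qed.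

Lemma I010 : I01 (0 : R).
Proof. by apply/I01P; rewrite lexx ler01. Qed.

Lemma I011 : I01 (1 : R).
Proof. by apply/I01P; rewrite lexx ler01. Qed.

Lemma triangleP (p : R * R) : triangle p <-> [/\ 0 <= p.2, p.2 <= p.1 & p.1 <= 1].
Proof.
split.
  by move=> [[/= /I01P/andP[_ ?] /I01P/andP[? _]] ?]; split.
by move=> [a b c]; split => //=; split; apply/I01P/andP; split => //;
  [exact: le_trans b|exact: le_trans c].
Qed.

Lemma measurable_tri t : measurable (tri t).
Proof.
apply: measurable_fun_le; first exact: measurable_triangle.
  exact: measurable_funTS measurable_fst.
exact: measurable_cst.
Qed.

Lemma tri1 : tri 1 = triangle.
Proof.
by apply/seteqP; split => [p []//|p tp]; split => //; have [] := iffLR (triangleP p) tp.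
Qed.

Lemma tri_sub a b : a <= b -> tri a `<=` tri b.
Proof. by move=> ab p [tp /= pa]; split => //=; exact: le_trans ab. Qed.

Lemma tri_snd t p : tri t p -> I01 p.2.
Proof. by move=> [[[]]]. Qed.

Lemma measurable_fst_preimage (A : set R) : measurable A ->
  measurable (fst @^-1` A : set (R * R)).
Proof.
by move=> mA; rewrite -[X in measurable X]setTI; exact: measurable_fst.
Qed.

Lemma measurable_snd_preimage (A : set R) : measurable A ->
  measurable (snd @^-1` A : set (R * R)).
Proof.
by move=> mA; rewrite -[X in measurable X]setTI; exact: measurable_snd.
Qed.

Section fixed_gamma.
Variable gamma : probability (R * R)%type R.
Hypothesis gG : Gamma gamma.

Lemma probability_setI1 (A : set (R * R)) : measurable A ->
  gamma (triangle `&` A) = gamma A.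
Proof.
move=> mA; have [g1 _] := gG; have mT := @measurable_triangle R.
have g0 : gamma (~` triangle) = 0%E.
  by rewrite probability_setC// g1 subee.
apply/eqP; rewrite eq_le; apply/andP; split.
  by apply: le_measure; rewrite ?inE//; exact: measurableI.
apply: (@le_trans _ _ (gamma ((triangle `&` A) `|` ~` triangle))).
  apply: le_measure; rewrite ?inE//.
    by apply: measurableU; [exact: measurableI|exact: measurableC].
  by move=> p Ap; have [tp|tp] := pselect (triangle p); [left|right].
rewrite -[leRHS]adde0 -[X in (_ + X)%E]g0; apply: measureU2.
  exact: measurableI.
exact: measurableC.
Qed.

Lemma gamma_fst (A : set R) : measurable A ->
  gamma (triangle `&` fst @^-1` A) = leb (A `&` I01).
Proof.
move=> mA; rewrite probability_setI1; last exact: measurable_fst_preimage.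
by case: gG => _ /(_ A mA).
Qed.

Lemma gamma_slab a b : 0 <= a -> a <= b -> b <= 1 ->
  gamma (tri b `\` tri a) = (b - a)%:E.
Proof.
move=> a0 ab b1.
have -> : tri b `\` tri a = triangle `&` fst @^-1` `]a, b]%classic.
  apply/seteqP; split => p.
    move=> [[tp pb] np]; split => //=; rewrite in_itv/= pb andbT ltNge.
    by apply/negP => pa; apply: np.
  move=> [tp /=]; rewrite in_itv/= => /andP[ap pb].
  by split => // -[_ /=]; rewrite leNgt ap.
rewrite gamma_fst// setIidl; last first.
  move=> x /=; rewrite in_itv/= => /andP[ax xb]; apply/I01P.
  by rewrite (le_trans a0 (ltW ax)) (le_trans xb).
rewrite lebesgue_measure_itv/= lte_fin.
case: ltP => [//|ba]; have /eqP -> : a == b by rewrite eq_le ab.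
by rewrite subrr.
Qed.

Lemma gamma_tri t : I01 t -> gamma (tri t) = t%:E.
Proof.
move=> /I01P/andP[t0 t1].
have -> : tri t = triangle `&` fst @^-1` `]-oo, t]%classic.
  by apply/seteqP; split => p [tp /=]; rewrite ?in_itv/= => pt; split => //=; rewrite in_itv.
rewrite gamma_fst//.
have -> : `]-oo, t] `&` I01 = `[0, t]%classic.
  apply/seteqP; split => x /=; rewrite /I01/= !in_itv/=.
    by move=> [-> /andP[-> _]].
  by move=> /andP[-> xt]; split => //; rewrite (le_trans xt).
rewrite lebesgue_measure_itv/= lte_fin.
case: ltP => [_|t00]; first by rewrite oppr0 adde0.
by congr EFin; apply/eqP; rewrite eq_le t00 t0.
Qed.

Lemma gamma_lty A : measurable A -> (gamma A < +oo)%E.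
Proof. by move=> mA; rewrite (le_lt_trans (probability_le1 _ _))// ltry. Qed.

End fixed_gamma.

Lemma measurable_within1 (psi : R -> R) : {within I01, continuous psi} ->
  measurable_fun I01 psi.
Proof. by move=> c; exact: subspace_continuous_measurable_fun (measurable_I01) c. Qed.

Lemma measurable_snd_fun (psi : R -> R) (A : set (R * R)) :
  measurable A -> (forall p, A p -> I01 p.2) -> measurable_fun I01 psi ->
  measurable_fun A (fun p => psi p.2).
Proof.
move=> mA AI mpsi.
apply: (@measurable_comp _ _ _ _ _ _ I01 psi A snd) => //.
- exact: measurable_I01.
- by move=> _ [p Ap <-]; exact: AI.
- exact: measurable_funTS measurable_snd.
Qed.

End gamma.

(** * The integral equation *)

Lemma compact_triangle (R : realType) : compact (triangle : set (R * R)).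
Proof.
apply: compact_closedI; first exact: compact_setX compact_I01 compact_I01.
have -> : [set p : R * R | p.2 <= p.1] =
    (fun p : R * R => p.1 - p.2) @^-1` [set x | 0 <= x].
  by apply/seteqP; split => p /=; rewrite subr_ge0.
apply: closed_comp; last exact: closed_ge.
by move=> p _; apply: cvgB; [exact: cvg_fst|exact: cvg_snd].
Qed.

Lemma measurable_within_prod (R : realType) (D : set (R * R))
    (phi : R * R -> R) :
  measurable D -> {within D, continuous phi} -> measurable_fun D phi.
Proof.
move=> mD /continuousP cphi; apply: (measurability _ (RGenOpens.measurableE R)).
move=> _ [_ [a [b ->] <-]].
have oab : open (`]a, b[%classic : set R) by exact: interval_open.
have /cphi/open_subspaceP[V oV VD] := oab.
by rewrite setIC -VD; apply: measurableI => //; exact: open_measurable2.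
Qed.

Lemma is_derive_exp_primitive (R : realType) (c s : R) : c != 0 ->
  is_derive s 1 (fun s => c^-1 * expR (c * s)) (expR (c * s)).
Proof.
move=> c0; have H1 : is_derive s 1 (fun s : R => c * s) (c *: 1).
  exact: is_deriveZ.
have H2 := @is_derive1_comp R expR (fun s => c * s) s _ _ (is_derive_expR _) H1.
have := @is_deriveZ _ _ _ _ c^-1 _ _ _ H2.
rewrite /GRing.scale/= mulr1.
by rewrite [in X in _ -> X](_ : expR (c * s) = c^-1 * (expR (c * s) * c)) // mulrCA mulVf ?mulr1.
Qed.

(** As s <= tau on the triangle and the weight increases, s may be replaced by tau, whose law is the
    Lebesgue measure. The primitive then gains the factor 1 / (2 K), and K / (2 K) = 1/2. *)
Lemma tri_weight (R : realType) (gamma : probability (R * R)%type R) (K t : R) :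
  Gamma gamma -> 0 < K -> I01 t ->
  K * \int[gamma]_(p in tri t) expR (2 * K * p.2) <= expR (2 * K * t) / 2.
Proof.
move=> gG K0 It; have /I01P/andP[t0 t1] := It.
pose w (s : R) := expR (2 * K * s).
have cw : continuous w.
  by move=> s; apply: continuous_comp; [exact: mulrl_continuous|exact: continuous_expR].
have mw : measurable_fun setT w by exact: continuous_measurable_fun.
have K20 : 0 < 2 * K by lra.
have dF (s : R) : is_derive s 1 (fun s : R => (2 * K)^-1 * w s) (w s).
  by apply: is_derive_exp_primitive; rewrite gt_eqF.
have leb_w : (\int[lebesgue_measure]_(s in `[0%R, t]) (w s)%:E
    <= ((2 * K)^-1 * w t)%:E)%E.
  (* The fundamental theorem of calculus is applied on a nondegenerate interval only. *)
  have [t00|tn0] := eqVneq t 0.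
    rewrite t00 set_itv1 integral_set1 lee_fin mulr_ge0// ?expR_ge0// invr_ge0 ltW//.
  have tpos : 0 < t by rewrite lt_neqAle eq_sym tn0.
  rewrite (@continuous_FTC2 _ w (fun s => (2 * K)^-1 * w s)) //.
  - rewrite -EFinB lee_fin gerBl// mulr_ge0// ?expR_ge0// invr_ge0 ltW//.
  - exact: continuous_subspaceT.
  - split.
    + by move=> s _; have [] := dF s.
    + by apply: cvg_at_right_filter; apply: cvgM; [exact: cvg_cst|exact: cw].
    + by apply: cvg_at_left_filter; apply: cvgM; [exact: cvg_cst|exact: cw].
  - by move=> s _; rewrite derive1E; have [_ ->] := dF s.
have lty := @gamma_lty _ gamma.
have mD := @measurable_tri R t.
have wle p : tri t p -> `|w p.2| <= w t /\ `|w p.1| <= w t.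
  move=> [/triangleP[p0 p21 p1] /= pt]; rewrite !ger0_norm ?expR_ge0// !ler_expR.
  by split; rewrite ler_pM2l//; lra.
have i1 : gamma.-integrable (tri t) (EFin \o (fun p => w p.2)).
  apply: (@integrable_bdd _ _ _ _ _ _ (w t)) => //; first exact: lty.
    by apply: measurable_funTS; apply: measurableT_comp.
  by move=> p /wle[].
have i2 : gamma.-integrable (tri t) (EFin \o (fun p => w p.1)).
  apply: (@integrable_bdd _ _ _ _ _ _ (w t)) => //; first exact: lty.
    by apply: measurable_funTS; apply: measurableT_comp.
  by move=> p /wle[].
have le12 : \int[gamma]_(p in tri t) w p.2 <= \int[gamma]_(p in tri t) w p.1.
  apply: le_Rintegral => // p [/triangleP[p0 p21 p1] /= pt].
  by rewrite ler_expR ler_pM2l.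
have lefst : \int[gamma]_(p in tri t) w p.1 <= (2 * K)^-1 * w t.
  rewrite -lee_fin fineK; last exact: integrable_fin_num i2.
  apply: le_trans leb_w.
  (* [lebesgue_measure] lives on the alias [measurableTypeR R], so [fst] is repackaged with that
     codomain. *)
  have mX : measurable_fun setT (fst : R * R -> measurableTypeR R).
    by move=> mT A mA; exact: (measurable_fst mT A mA).
  pose X : {mfun (R * R)%type >-> measurableTypeR R} :=
    HB.pack (fst : R * R -> measurableTypeR R) (isMeasurableFun.Build _ _ _ _ _ mX).
  have -> : (\int[lebesgue_measure]_(s in `[0%R, t]) (w s)%:E =
     \int[pushforward gamma X]_(s in `[0%R, t]) (w s)%:E)%E.
    apply: (eq_measure_integral (pushforward gamma X)) => A mA At.
    case: gG => _ /(_ A mA) gA; rewrite -[A in LHS](_ : A `&` I01 = A) ?gA//.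
    apply/setIidl => x /At /=; rewrite in_itv/= => /andP[x0 xt].
    by apply/I01P; rewrite x0 (le_trans xt).
  rewrite ge0_integral_pushforward//; last 2 first.
  - apply: measurable_funTS; apply: measurableT_comp => //.
  - by move=> s _; rewrite lee_fin expR_ge0.
  apply: ge0_subset_integral => //.
  - by apply: measurable_fst_preimage.
  - by apply/measurable_EFinP; apply: measurable_funTS; apply: measurableT_comp.
  - by move=> s _; rewrite lee_fin expR_ge0.
  - by move=> p [/triangleP[p0 p21 p1] /= pt]; rewrite /= in_itv/= pt andbT; lra.
have : K * \int[gamma]_(p in tri t) w p.2 <= K * ((2 * K)^-1 * w t).
  by rewrite ler_pM2l// (le_trans le12).
rewrite -/(w t); suff -> : K * ((2 * K)^-1 * w t) = w t / 2 by [].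
by field; rewrite gt_eqF.
Qed.

Section integral_equation.
Context (R : realType) (d : nat).
Variables (x0 : 'rV[R]_d) (f : R -> 'rV[R]_d -> 'rV[R]_d).
Implicit Types (gamma : probability (R * R)%type R) (x : R -> 'rV[R]_d).

Definition coord_cont x := forall i, {within I01, continuous (fun t => x t 0 i)}.

Lemma coord_contP x : {within I01, continuous x} <-> coord_cont x.
Proof.
split => cx.
  move=> i t; apply: (@continuous_comp (subspace I01) _ _ x (fun M => M 0 i)).
    exact: cx.
  exact: coord_continuous.
apply/subspace_continuousP => t It; apply/cvg_ballP => e e0.
have H j : \forall s \near within I01 (nbhs t), ball (x t 0 j) e (x s 0 j).
  by have /subspace_continuousP/(_ _ It)/cvg_ballP/(_ _ e0) := cx j.
near=> s; split => // i j; rewrite (ord1 i).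
by move: j; near: s; exact: filter_forall.
Unshelve. all: by end_near. Qed.

Lemma within_graph (phi : R * 'rV[R]_d -> R) x :
  {within I01 `*` [set: 'rV[R]_d], continuous phi} -> coord_cont x ->
  {within I01, continuous (fun s => phi (s, x s))}.
Proof.
move=> cphi /coord_contP/subspace_continuousP cx.
apply/subspace_continuousP => s Is.
have /subspace_continuousP/(_ (s, x s)) := cphi.
move=> /(_ (conj Is I)) cphis.
apply: (cvg_comp (fun s => (s, x s)) phi) cphis => A.
rewrite /within/= => -[[U V]/= [Us Vs] UV].
have := cx s Is _ Vs; rewrite /= /within => H.
change (\forall y \near s, I01 y -> A (y, x y)).
near=> y => Iy; apply: (UV (y, x y)); last by split.
by split => /=; [near: y; exact: Us|move: Iy; near: y; exact: H].
Unshelve. all: by end_near. Qed.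

Hypothesis f_cont : {within I01 `*` [set: 'rV[R]_d],
  continuous (fun p : R * 'rV[R]_d => f p.1 p.2)}.

Lemma within_vfield x i : coord_cont x ->
  {within I01, continuous (fun s => f s (x s) 0 i)}.
Proof.
move=> cx; apply: (within_graph (phi := fun p => f p.1 p.2 0 i)) => // p.
apply: (@continuous_comp (subspace _) _ _ (fun p : R * 'rV[R]_d => f p.1 p.2)
  (fun M : 'rV[R]_d => M 0 i)); first exact: f_cont.
exact: coord_continuous.
Qed.

Definition inteq gamma x := coord_cont x /\
  forall t, I01 t -> forall i,
    x t 0 i = x0 0 i + \int[gamma]_(p in tri t) f p.2 (x p.2) 0 i.

End integral_equation.

Section moments.
Context (R : realType).
Implicit Types (gamma : probability (R * R)%type R) (psi : R -> R).

Lemma integrable_tri gamma psi t : {within I01, continuous psi} ->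
  gamma.-integrable (tri t) (EFin \o (fun p => psi p.2)).
Proof.
move=> cpsi; have [M M0 HM] := compact_bdd (@compact_I01 R) cpsi.
have mt := measurable_tri t.
apply: (@integrable_bdd _ _ _ _ _ _ M) => //; first exact: gamma_lty.
  apply: measurable_snd_fun => //; first exact: tri_snd.
  exact: measurable_within1.
by move=> p /tri_snd; exact: HM.
Qed.

(** The slab has mass b - a whatever the measure in [Gamma]; this uniformity carries all later
    equicontinuity in t. *)
Lemma tri_slab_bdd gamma (phi : R * R -> R) M a b : Gamma gamma ->
  0 <= a -> a <= b -> b <= 1 -> 
  gamma.-integrable (tri b) (EFin \o phi) ->
  (forall p, (tri b `\` tri a) p -> `|phi p| <= M) ->
  `|\int[gamma]_(p in tri b) phi p - \int[gamma]_(p in tri a) phi p|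
     <= M * (b - a).
Proof.
move=> gG a0 ab b1 iphi HM.
have [ma mb] := (measurable_tri a, measurable_tri b).
rewrite (Rintegral_setD ma mb (tri_sub ab) iphi) addrAC subrr add0r.
have -> : b - a = fine (gamma (tri b `\` tri a)) by rewrite gamma_slab.
have mba := measurableD mb ma.
apply: Rintegral_bdd => //; first exact: gamma_lty.
apply/measurable_EFinP/measurable_int.
by apply: integrableS iphi => //; exact: subDsetl.
Qed.

End moments.

(** * Contraction in a weighted norm and stability of trajectories *)

Section gronwall.
Context (R : realType) (d : nat) (f : R -> 'rV[R]_d -> 'rV[R]_d) (K : R).
Hypothesis K0 : 0 < K.
Hypothesis f_lip : forall s, I01 s -> forall (y z : 'rV[R]_d) (r : R),
  (forall i, `|y 0 i - z 0 i| <= r) ->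
  forall i, `|f s y 0 i - f s z 0 i| <= K * r.
Hypothesis f_cont : {within I01 `*` [set: 'rV[R]_d],
  continuous (fun p : R * 'rV[R]_d => f p.1 p.2)}.

(* The weight [expR (2 K s)] makes the integral operator a contraction of
   ratio 1/2. *)
Lemma vfield_contraction gamma (x y : R -> 'rV[R]_d) B : Gamma gamma ->
  coord_cont x -> coord_cont y -> 
  (forall s, I01 s -> forall i,
     `|x s 0 i - y s 0 i| <= B * expR (2 * K * s)) ->
  forall t, I01 t -> forall i,
   `|\int[gamma]_(p in tri t) f p.2 (x p.2) 0 i -
     \int[gamma]_(p in tri t) f p.2 (y p.2) 0 i| <=
   B / 2 * expR (2 * K * t).
Proof.
move=> gG cx cy xyB t It i.
have [i1 i2] := (integrable_tri gamma t (within_vfield f_cont cx (i := i)),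
  integrable_tri gamma t (within_vfield f_cont cy (i := i))).
have mt := measurable_tri t.
have iw : gamma.-integrable (tri t) (EFin \o (fun p => expR (2 * K * p.2))).
  apply: (integrable_tri gamma t (psi := fun s => expR (2 * K * s))).
  apply: continuous_subspaceT => s.
  by apply: continuous_comp; [exact: mulrl_continuous|exact: continuous_expR].
rewrite -RintegralB//; apply: le_trans (le_normr_Rintegral mt _) _.
  by have := integrableB mt i1 i2.
apply: (@le_trans _ _ (\int[gamma]_(p in tri t) (K * B * expR (2 * K * p.2)))).
  apply: le_Rintegral => //.
  - by apply: (integrable_norm (f := fun p => f p.2 (x p.2) 0 i - f p.2 (y p.2) 0 i)); have := integrableB mt i1 i2.
  - exact: (integrableZl mt (K * B) iw).
  - move=> p /tri_snd Ip; rewrite -mulrA; apply: f_lip => // j; exact: xyB.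
rewrite RintegralZl//.
have B0 : 0 <= B.
  have := xyB _ I010 i; rewrite mulr0 expR0 mulr1; exact: le_trans.
by have := ler_wpM2l B0 (tri_weight gG K0 It); lra.
Qed.

(** Inserting the integral of f along [y] against [gamma1], the contraction turns a bound B on the
    weighted distance into A + B / 2. Iterating from any finite bound leads to the fixed point 2 A,
    and expR (2 K) bounds the weight on [0,1]. *)
Lemma gronwall (x0 : 'rV[R]_d) gamma1 gamma2 (x y : R -> 'rV[R]_d) A :
  Gamma gamma1 -> 0 <= A -> inteq x0 f gamma1 x -> inteq x0 f gamma2 y ->
  (forall t, I01 t -> forall i,
    `|\int[gamma1]_(p in tri t) f p.2 (y p.2) 0 i -
      \int[gamma2]_(p in tri t) f p.2 (y p.2) 0 i| <= A) ->
  forall t, I01 t -> forall i, `|x t 0 i - y t 0 i| <= 2 * A * expR (2 * K).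
Proof.
move=> gG A0 [cx xE] [cy yE] HA.
have w1 s : I01 s -> 1 <= expR (2 * K * s).
  by move=> /I01P/andP[s0 _]; rewrite -[leLHS]expR0 ler_expR mulr_ge0// mulr_ge0// ltW.
have [M M0 HM] : exists2 M : R, 0 <= M & forall s, I01 s -> forall i,
    `|x s 0 i - y s 0 i| <= M.
  have /choice[M HM] : forall i, exists M, 0 <= M /\ forall s, I01 s ->
      `|x s 0 i - y s 0 i| <= M.
    move=> i; have [Mx Mx0 HMx] := compact_bdd (@compact_I01 R) (cx i).
    have [My My0 HMy] := compact_bdd (@compact_I01 R) (cy i).
    exists (Mx + My); split; first exact: addr_ge0.
    by move=> s Is; rewrite (le_trans (ler_normB _ _))// lerD// ?HMx ?HMy.
  exists (\sum_i M i); first by apply: sumr_ge0 => i _; case: (HM i).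
  move=> s Is i; rewrite (bigD1 i)//=; have [_ /(_ s Is) h] := HM i.
  rewrite (le_trans h)// lerDl; apply: sumr_ge0 => j _; by case: (HM j).
have iter n : forall s, I01 s -> forall i,
   `|x s 0 i - y s 0 i| <= (2 * A + M * 2^-1 ^+ n) * expR (2 * K * s).
  elim: n => [|n IH] s Is i.
    rewrite expr0 mulr1 (le_trans (HM s Is i))//.
    rewrite (@le_trans _ _ (2 * A + M))// ?lerDr ?mulr_ge0//.
    by rewrite ler_peMr ?w1// addr_ge0// mulr_ge0.
  rewrite xE// yE// opprD addrACA subrr add0r.
  have h1 := vfield_contraction gG cx cy IH Is i.
  have h2 := HA s Is i.
  have h3 := w1 s Is.
  rewrite (le_trans (ler_distD (\int[gamma1]_(p in tri s) f p.2 (y p.2) 0 i) _ _))//.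
  apply: le_trans (lerD h1 h2) _.
  rewrite exprS; set e := expR _ in h3 *; set q := _ ^+ n.
  have : A <= A * e by rewrite ler_peMr.
  by nra.
move=> t It i; apply: (@le_trans _ _ (2 * A * expR (2 * K * t))).
  apply/ler_addgt0Pr => e e0.
  have : M * expR (2 * K * t) * 2^-1 ^+ n @[n --> \oo] --> M * expR (2 * K * t) * 0.
    apply: cvgM; first exact: cvg_cst.
    by apply: cvg_expr; rewrite ger0_norm// invf_lt1// ltr1n.
  rewrite mulr0 => /cvgrPdist_lt/(_ _ e0)[N _ /(_ N (leqnn N))].
  rewrite sub0r normrN => hN; apply: le_trans (iter N t It i) _.
  rewrite mulrDl lerD2l mulrAC; apply: le_trans (ltW hN); exact: ler_norm.
have /I01P/andP[t0 t1] := It.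
rewrite ler_wpM2l ?mulr_ge0// ler_expR.
by rewrite ler_piMr// mulr_ge0// ltW.
Qed.

End gronwall.

(** * Existence of trajectories; disintegrations *)

Lemma le_geometric0 (R : realType) (a c : R) :
  (forall n, a <= c * 2^-1 ^+ n) -> a <= 0.
Proof.
move=> H; apply/ler_addgt0Pr => e e0; rewrite add0r.
have : c * 2^-1 ^+ n @[n --> \oo] --> c * 0.
  apply: cvgM; first exact: cvg_cst.
  by apply: cvg_expr; rewrite ger0_norm// invf_lt1// ltr1n.
rewrite mulr0 => /cvgrPdist_lt/(_ _ e0)[N _ /(_ N (leqnn N))].
rewrite sub0r normrN => hN; apply: le_trans (H N) _.
by apply: le_trans (ltW hN); exact: ler_norm.
Qed.

(** The intervals of radius c / 2^n around u n meet pairwise, so the supremum of their left ends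
    lies in all of them; this gives the limit together with its rate. *)
Lemma geometric_limit (R : realType) (u : nat -> R) (c : R) :
  (forall n, `|u n.+1 - u n| <= c * 2^-1 ^+ n.+1) ->
  exists l, forall n, `|l - u n| <= c * 2^-1 ^+ n.
Proof.
move=> H.
have Hm n m : `|u (n + m)%N - u n| <= c * 2^-1 ^+ n - c * 2^-1 ^+ (n + m).
  elim: m => [|m IH]; first by rewrite addn0 !subrr normr0.
  rewrite addnS; have := H (n + m)%N.
  move=> h; apply: le_trans (ler_distD (u (n + m)%N) _ _) _.
  apply: le_trans (lerD h IH) _.
  by rewrite exprS; lra.
have c0 : 0 <= c.
  by have := le_trans (normr_ge0 _) (H 0%N); rewrite expr1 pmulr_lge0.
have Hc n : 0 <= c * 2^-1 ^+ n by rewrite mulr_ge0// exprn_ge0// invr_ge0.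
have Hnm n m : u n - c * 2^-1 ^+ n <= u m + c * 2^-1 ^+ m.
  have [nm|/ltnW mn] := leqP n m.
    have := Hm n (m - n)%N; rewrite subnKC// => h.
    by have := Hc m; have := ler_norm (- (u m - u n)); rewrite normrN; lra.
  have := Hm m (n - m)%N; rewrite subnKC// => h.
  by have := Hc n; have := ler_norm (u n - u m); lra.
pose S := [set u n - c * 2^-1 ^+ n | n in [set: nat]].
have S0 : S !=set0 by exists (u 0%N - c * 2^-1 ^+ 0); exists 0%N.
have ubS m : ubound S (u m + c * 2^-1 ^+ m) by move=> _ [n _ <-].
exists (sup S) => n; rewrite ler_distl; apply/andP; split.
  by apply: ub_le_sup; [exists (u 0%N + c * 2^-1 ^+ 0)|exists n].
by apply: ge_sup.
Qed.

Lemma lipschitz_within (R : realType) (u : R -> R) (M : R) :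
  (forall a b, I01 a -> I01 b -> a <= b -> `|u b - u a| <= M * (b - a)) ->
  {within I01, continuous u}.
Proof.
move=> H; apply/subspace_continuousP => t It; apply/cvgrPdist_lt => e e0.
have M0 : 0 < `|M| + 1 by rewrite ltr_pwDr.
have eM : 0 < e / (`|M| + 1) by rewrite divr_gt0.
rewrite near_withinE; near=> s => Is.
have ts : `|t - s| < e / (`|M| + 1) by near: s; exact: nbhsx_ballx.
have h : `|u t - u s| <= M * `|t - s|.
  have [ts'|/ltW st'] := leP (t : R) s.
    by rewrite distrC (distrC t) [`|s - t|]ger0_norm ?subr_ge0// H.
  by rewrite [`|t - s|]ger0_norm ?subr_ge0// H.
apply: le_lt_trans h _; apply: (@le_lt_trans _ _ ((`|M| + 1) * `|t - s|)).
  by rewrite ler_wpM2r// (le_trans (ler_norm _))// lerDl.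
by rewrite mulrC -ltr_pdivlMr.
Unshelve. all: by end_near. Qed.

(** * Picard iteration *)

Section picard.
Context (R : realType) (d : nat) (f : R -> 'rV[R]_d -> 'rV[R]_d) (K : R).
Hypothesis K0 : 0 < K.
Hypothesis f_lip : forall s, I01 s -> forall (y z : 'rV[R]_d) (r : R),
  (forall i, `|y 0 i - z 0 i| <= r) ->
  forall i, `|f s y 0 i - f s z 0 i| <= K * r.
Hypothesis f_cont : {within I01 `*` [set: 'rV[R]_d],
  continuous (fun p : R * 'rV[R]_d => f p.1 p.2)}.
Variables (x0 : 'rV[R]_d) (gamma : probability (R * R)%type R).
Hypothesis gG : Gamma gamma.

Let Phi (x : R -> 'rV[R]_d) (t : R) : 'rV[R]_d :=
  \row_i (x0 0 i + \int[gamma]_(p in tri t) f p.2 (x p.2) 0 i).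

Lemma tri_lipschitz (psi : R -> R) : {within I01, continuous psi} ->
  exists2 M : R, 0 <= M & forall a b, I01 a -> I01 b -> a <= b ->
  `|\int[gamma]_(p in tri b) psi p.2 - \int[gamma]_(p in tri a) psi p.2|
     <= M * (b - a).
Proof.
move=> cpsi; have [M M0 HM] := compact_bdd (@compact_I01 R) cpsi.
exists M => // a b /I01P/andP[a0 _] /I01P/andP[_ b1] ab.
apply: tri_slab_bdd => //; first exact: integrable_tri.
by move=> p [/tri_snd Ip _]; exact: HM.
Qed.

Lemma Rintegral_tri0 (psi : R -> R) : {within I01, continuous psi} ->
  \int[gamma]_(p in tri 0) psi p.2 = 0.
Proof.
move=> cpsi; apply/eqP; rewrite -normr_le0.
have [N N0 HN] := compact_bdd (@compact_I01 R) cpsi.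
have g0 : fine (gamma (tri (0:R))) = 0 by rewrite gamma_tri//; exact: I010.
apply: (@le_trans _ _ (N * fine (gamma (tri 0)))); last by rewrite g0 mulr0.
apply: Rintegral_bdd => //.
- exact: measurable_tri.
- by apply: gamma_lty; exact: measurable_tri.
- exact/measurable_EFinP/measurable_int/(integrable_tri gamma 0 cpsi).
- by move=> p /tri_snd; exact: HN.
Qed.

Let coord_cont_Phi x : coord_cont x -> coord_cont (Phi x).
Proof.
move=> cx i; have [M _ HM] := tri_lipschitz (within_vfield f_cont cx (i := i)).
apply: (@lipschitz_within _ _ M) => a b Ia Ib ab.
by rewrite !mxE opprD addrACA subrr add0r; exact: HM.
Qed.

Let w (t : R) := expR (2 * K * t).

Let w_bounds t : I01 t -> 1 <= w t <= w 1.
Proof.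
move=> /I01P/andP[t0 t1]; rewrite /w -[leLHS]expR0 !ler_expR.
by rewrite mulr_ge0 ?ler_wpM2l// mulr_ge0// ltW.
Qed.

Lemma picard : exists x, inteq x0 f gamma x.
Proof.
pose xn n := iter n Phi (cst x0).
have cc0 : coord_cont (cst x0 : R -> 'rV[R]_d).
  by move=> i; apply: continuous_subspaceT => t; exact: cst_continuous.
have ccn n : coord_cont (xn n).
  by elim: n => [//|n IH]; exact: coord_cont_Phi.
have [C C0 HC] : exists2 C : R, 0 <= C & forall t, I01 t -> forall i,
    `|xn 1%N t 0 i - xn 0%N t 0 i| <= C.
  have /choice[M HM] : forall i, exists M, 0 <= M /\ forall t, I01 t ->
      `|xn 1%N t 0 i - xn 0%N t 0 i| <= M.
    move=> i; have [M M0 HM] := tri_lipschitz (within_vfield f_cont cc0 (i := i)).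
    exists M; split=> // t It; have /I01P/andP[t0 t1] := It.
    have /= := HM 0 t I010 It t0; rewrite !mxE addrAC subrr add0r subr0.
    rewrite (@Rintegral_tri0 (fun s => f s x0 0 i)); last first.
      exact: (within_vfield f_cont cc0 (i := i)).
    by rewrite subr0 => h; apply: le_trans h _; rewrite ler_piMr.
  exists (\sum_i M i); first by apply: sumr_ge0 => i _; case: (HM i).
  move=> s Is i; rewrite (bigD1 i)//=; have [_ /(_ s Is) h] := HM i.
  by rewrite (le_trans h)// lerDl; apply: sumr_ge0 => j _; case: (HM j).
have xnS n t i : xn n.+1 t 0 i =
    x0 0 i + \int[gamma]_(p in tri t) f p.2 (xn n p.2) 0 i by rewrite mxE.
have Hstep n : forall t, I01 t -> forall i,
    `|xn n.+1 t 0 i - xn n t 0 i| <= C * 2^-1 ^+ n * w t.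
  elim: n => [|n IH] t It i.
    rewrite expr0 mulr1 (le_trans (HC t It i))// ler_peMr//.
    by case/andP: (w_bounds It).
  rewrite !xnS.
  rewrite opprD addrACA subrr add0r.
  have := vfield_contraction K0 f_lip f_cont gG (ccn n.+1) (ccn n) IH It i.
  by rewrite exprS; congr (_ <= _); rewrite -/(w t); ring.
(* The n-th step is at most C 2^-n w t <= C 2^-n w 1, that is c 2^-(n+1), the form required by
   [geometric_limit]. *)
pose c := 2 * C * w 1.
have /choice[xl Hxl] : forall ti : R * 'I_d, exists l, I01 ti.1 -> forall n,
    `|l - xn n ti.1 0 ti.2| <= c * 2^-1 ^+ n.
  move=> [t i]/=; have [It|] := pselect (I01 t); last by exists 0.
  have [|l Hl] := @geometric_limit _ (fun n => xn n t 0 i) c; last by exists l.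
  move=> n; apply: le_trans (Hstep n t It i) _.
  rewrite exprS /c; have /andP[_ w1] := w_bounds It.
  have q0 : 0 <= C * 2^-1 ^+ n :> R by rewrite mulr_ge0// exprn_ge0// invr_ge0.
  by have := ler_wpM2l q0 w1; lra.
pose x t : 'rV[R]_d := \row_i xl (t, i).
have Hx n t i : I01 t -> `|x t 0 i - xn n t 0 i| <= c * 2^-1 ^+ n.
  by move=> It; rewrite mxE; exact: (Hxl (t, i)).
have ccx : coord_cont x.
  move=> i; apply/subspace_continuousP => t It; apply/cvgrPdist_le => e e0.
  have [N HN] : exists N, c * 2^-1 ^+ N <= e / 3.
    apply: contrapT => /forallNP Hn; have : e / 3 <= 0 :> R; last by lra.
    by apply: (@le_geometric0 _ _ c) => n; have /negP := Hn n; rewrite -ltNge => /ltW.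
  have e30 : 0 < e / 3 by lra.
  have /subspace_continuousP/(_ _ It)/cvgrPdist_le/(_ _ e30) := ccn N i.
  rewrite !near_withinE; apply: filterS => s Hs Is.
  have h1 := le_trans (Hx N t i It) HN; have h2 := le_trans (Hx N s i Is) HN.
  have h3 := Hs Is; move: h1 h2 h3; rewrite !ler_norml /from_subspace.
  by move=> /andP[? ?] /andP[? ?] /andP[? ?]; apply/andP; split; lra.
(* The defect of [x] in the equation is compared with the iterate n + 1, which is the integral
   operator applied to the iterate n; both differences decay geometrically. *)
exists x; split => // t It i; apply/eqP; rewrite -subr_eq0 -normr_le0.
apply: (@le_geometric0 _ _ (c * w 1)) => n.
have h1 := Hx n.+1 t i It.
have c0 : 0 <= c * 2^-1 ^+ n.
  by apply: le_trans (Hx n t i It); exact: normr_ge0.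
have h2 : `|\int[gamma]_(p in tri t) f p.2 (xn n p.2) 0 i -
    \int[gamma]_(p in tri t) f p.2 (x p.2) 0 i| <= c * 2^-1 ^+ n / 2 * w t.
  apply: (vfield_contraction K0 f_lip f_cont gG (ccn n) ccx) => // s Is j.
  rewrite distrC (le_trans (Hx n s j Is))// ler_peMr//.
  by case/andP: (w_bounds Is).
rewrite xnS in h1.
have /andP[w1 w2] := w_bounds It.
have w3 := ler_wpM2l c0 w2; have w4 := ler_wpM2l c0 (le_trans w1 w2).
rewrite -[X in `|X|](subrKA (x0 0 i + \int[gamma]_(p in tri t) f p.2 (xn n p.2) 0 i)).
apply: le_trans (ler_normD _ _) _.
rewrite [X in _ + `|X|](_ : _ = \int[gamma]_(p in tri t) f p.2 (xn n p.2) 0 i -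
    \int[gamma]_(p in tri t) f p.2 (x p.2) 0 i); last by ring.
apply: le_trans (lerD h1 h2) _.
by rewrite exprS; lra.
Qed.

End picard.

(** Used with [N] a null set, to drop the mass off the triangle or off [0, tau], and with [N] a thin
    strip, the only place where a cutoff differs from an indicator. *)
Lemma Rintegral_cut d (T : measurableType d) (R : realType)
    (mu : {measure set T -> \bar R}) (A B N : set T) (f : T -> R) (M : R) :
  measurable A -> measurable B -> measurable N -> A `<=` B ->
  (mu B < +oo)%E -> (mu N < +oo)%E -> measurable_fun B f -> 0 <= M ->
  (forall x, B x -> `|f x| <= M) ->
  (forall x, B x -> ~ A x -> ~ N x -> f x = 0) ->
  `|\int[mu]_(x in B) f x - \int[mu]_(x in A) f x| <= M * fine (mu N).
Proof.
move=> mA mB mN AB Bfin Nfin mf M0 fM f0.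
have fi := integrable_bdd mB Bfin mf fM.
rewrite (Rintegral_setD mA mB AB fi) addrAC subrr add0r.
have mBA := measurableD mB mA.
have mBAN := measurableI _ _ mBA mN.
have sub : (B `\` A) `&` N `<=` B `\` A by exact: subIsetl.
have fiBA : mu.-integrable (B `\` A) (EFin \o f).
  by apply: integrableS fi => //; exact: subDsetl.
rewrite (Rintegral_setD mBAN mBA sub fiBA).
rewrite [X in _ + X](_ : _ = 0) ?addr0; last first.
  rewrite (@eq_Rintegral _ _ _ mu _ (fun=> 0)) ?Rintegral_cst ?mul0r//.
    by apply: measurableD.
  by move=> x /set_mem[[Bx nAx] nN]; apply: f0 => // Nx; apply: nN.
have le : (mu ((B `\` A) `&` N) <= mu N)%E by apply: le_measure; rewrite ?inE.
have fin := le_lt_trans le Nfin.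
apply: (@le_trans _ _ (M * fine (mu ((B `\` A) `&` N)))).
  apply: Rintegral_bdd => //.
    by apply: measurable_funS mf => // x [[]].
  by move=> x [[Bx _] _]; exact: fM.
by rewrite ler_wpM2l// fine_le// ge0_fin_numE.
Qed.

Lemma within_snd (R : realType) (D : set (R * R)) (psi : R -> R) :
  (forall p, D p -> I01 p.2) -> {within I01, continuous psi} ->
  {within D, continuous (fun p => psi p.2)}.
Proof.
move=> DI /subspace_continuousP cpsi; apply/subspace_continuousP => p Dp.
apply: (cvg_comp snd psi) (cpsi _ (DI _ Dp)) => A /= HA.
exists (setT, [set s | I01 s -> A s]) => /=.
  by split; [exact: filterT|exact: HA].
by move=> q [_ Hq] Dq; apply: Hq; exact: DI.
Qed.

(** * Testing a disintegration against cutoffs *)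

Section disintegrations.
Context (R : realType) (gamma : probability (R * R)%type R).
Hypothesis gG : Gamma gamma.
Local Notation leb := (@lebesgue_measure R).
Let square : set (R * R) := I01 `*` I01.

Lemma measurable_square : measurable square.
Proof. exact: measurableX measurable_I01 measurable_I01. Qed.

Lemma Rintegral_square (phi : R * R -> R) : {within square, continuous phi} ->
  \int[gamma]_(p in square) phi p = \int[gamma]_(p in triangle) phi p.
Proof.
move=> cphi; have [M M0 HM] := compact_bdd (compact_setX (@compact_I01 R) (@compact_I01 R)) cphi.
have mT := @measurable_triangle R.
have lty := @gamma_lty _ gamma.
apply/eqP; rewrite -subr_eq0 -normr_le0.
apply: (@le_trans _ _ (M * fine (gamma (~` triangle)))).
  apply: Rintegral_cut => //; do ?[exact: lty].
  - exact: measurable_square.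
  - exact: measurableC.
  - by move=> p [].
  - by apply: lty; exact: measurable_square.
  - by apply: lty; exact: measurableC.
  - exact: measurable_within2.
by have [g1 _] := gG; rewrite probability_setC// g1 subee//= mulr0.
Qed.

(** This is (t - x) / e + 1 clamped to [0,1]: 1 up to t, 0 from t + e on, affine between. Absolute
    values make its continuity immediate. *)
Let cutoff (t e x : R) : R := (`|(t - x) / e + 1| - `|(t - x) / e| + 1) / 2.

Let cutoff_le t e x : 0 < e -> x <= t -> cutoff t e x = 1.
Proof.
move=> e0 xt; rewrite /cutoff.
have h : 0 <= (t - x) / e by rewrite divr_ge0 ?subr_ge0// ltW.
by rewrite !ger0_norm ?addr_ge0//; lra.
Qed.

Let cutoff_ge t e x : 0 < e -> t + e <= x -> cutoff t e x = 0.
Proof.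
move=> e0 xt; rewrite /cutoff.
have h : (t - x) / e <= - 1 by rewrite ler_pdivrMr//; lra.
by rewrite !ler0_norm; lra.
Qed.

Let cutoff_norm t e x : `|cutoff t e x| <= 1.
Proof.
rewrite /cutoff; set y := (t - x) / e.
by have [h|h] := leP 0 (y + 1); have [h'|h'] := leP 0 y; rewrite ler_norml;
  rewrite ?(ger0_norm h) ?(ltr0_norm h) ?(ger0_norm h') ?(ltr0_norm h');
  apply/andP; split; lra.
Qed.

Let continuous_cutoff t e : continuous (cutoff t e).
Proof.
have cy : continuous (fun x : R => (t - x) / e).
  by move=> x; apply: cvgM; [apply: cvgB; [exact: cvg_cst|exact: cvg_id]|exact: cvg_cst].
move=> x; apply: cvgM; last exact: cvg_cst.
apply: cvgD; last exact: cvg_cst.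
apply: cvgB; last by apply: cvg_norm; exact: cy.
by apply: cvg_norm; apply: cvgD; [exact: cy|exact: cvg_cst].
Qed.

Lemma disintegration_tri (nu : R -> probability R R) (psi : R -> R) (t : R) :
  disintegration gamma nu -> {within I01, continuous psi} -> I01 t ->
  \int[leb]_(tau in `[0, t]) (\int[nu tau]_(s in `[0, tau]) psi s) =
  \int[gamma]_(p in tri t) psi p.2.
Proof.
move=> [nuI mnu nug] cpsi It; have /I01P/andP[t0 t1] := It.
have [M M0 HM] := compact_bdd (@compact_I01 R) cpsi.
have mpsi := measurable_within1 cpsi.
have mI := @measurable_I01 R; have mT := @measurable_triangle R.
have nufin tau (A : set R) : measurable A -> (nu tau A < +oo)%E.
  by move=> mA; rewrite (le_lt_trans (probability_le1 _ _))// ltry.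
pose H tau := \int[nu tau]_(s in I01) psi s.
(* [disintegration] integrates over [0,1], the equation of motion over [0, tau]; the two agree
   because [nu tau] charges only [0, tau]. *)
have Hnu tau : I01 tau -> \int[nu tau]_(s in `[0, tau]) psi s = H tau.
  move=> Itau; have /I01P/andP[tau0 tau1] := Itau.
  apply/eqP; rewrite eq_sym -subr_eq0 -normr_le0.
  apply: (@le_trans _ _ (M * fine (nu tau (~` `[0, tau]%classic)))).
    apply: Rintegral_cut => //; do ?[exact: nufin].
    - exact: measurableC.
    - by move=> x /=; rewrite in_itv/= => /andP[x0 xt]; apply/I01P; rewrite x0 (le_trans xt).
    - by apply: nufin; exact: measurableC.
  by rewrite probability_setC// nuI// subee//= mulr0.
have HM' tau : I01 tau -> `|H tau| <= M.
  move=> Itau; apply: (@le_trans _ _ (M * fine (nu tau I01))).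
    by apply: Rintegral_bdd => //; exact: nufin.
  by rewrite ler_piMr// -lee_fin fineK ?probability_le1// fin_num_measure.
have mH : measurable_fun (I01 : set R) H by exact: mnu.
have mH' : measurable_fun (I01 : set (measurableTypeR R)) H.
  by move=> _ A mA; exact: (mH mI A mA).
have lebI : leb I01 = 1%E by rewrite lebesgue_measure_itv/= lte_fin ltr01 oppr0 adde0.
rewrite (@eq_Rintegral _ _ _ leb _ H); last first.
  move=> tau /set_mem/=; rewrite in_itv/= => /andP[a b].
  by apply: Hnu; apply/I01P; rewrite a (le_trans b).
apply/eqP; rewrite -subr_eq0 -normr_le0; apply/ler_addgt0Pr => e' e'0.
rewrite add0r.
(* The cutoff costs at most M e on the side of [gamma] and M e on the side of the kernel, and 2 M e
   + e = e'. The summand 1 keeps the denominator positive when M = 0. *)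
pose e := e' / (2 * M + 1).
have M10 : 0 < 2 * M + 1 by lra.
have e0 : 0 < e by rewrite divr_gt0.
pose phi (p : R * R) := cutoff t e p.1 * psi p.2.
have cphi : {within square, continuous phi}.
  move=> p; apply: cvgM; last by apply: (within_snd _ cpsi) => q [].
  apply: (@continuous_subspaceT _ _ square (cutoff t e \o fst)) => q.
  by apply: continuous_comp; [exact: cvg_fst|exact: continuous_cutoff].
have phiM p : square p -> `|phi p| <= M.
  move=> [_ Ip2]; rewrite normrM -[leRHS]mul1r.
  by apply: ler_pM => //; exact: HM.
have := nug phi cphi; rewrite -/square Rintegral_square// => phiE.
have lebN : leb `]t, (t + e)%R[ = e%:E.
  rewrite lebesgue_measure_itv/= lte_fin ltrDl e0 -EFinB.
  by rewrite addrAC subrr add0r.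
have lebIfin : (leb I01 < +oo)%E by rewrite lebI ltry.
have lebNfin : (leb `]t, (t + e)%R[ < +oo)%E by rewrite lebN ltry.
have h1 : `|\int[gamma]_(p in triangle) phi p - \int[gamma]_(p in tri t) psi p.2| <= M * e.
  rewrite (_ : \int[gamma]_(p in tri t) psi p.2 = \int[gamma]_(p in tri t) phi p); last first.
    by apply: eq_Rintegral => p /set_mem[_ /= pt]; rewrite /phi cutoff_le// mul1r.
  have mN : measurable (triangle `&` fst @^-1` `]t, (t + e)%R[%classic : set (R * R)).
    by apply: measurableI => //; exact: measurable_fst_preimage.
  apply: (@le_trans _ _ (M * fine (gamma (triangle `&` fst @^-1` `]t, (t + e)%R[%classic)))).
    apply: Rintegral_cut => //; do ?[exact: gamma_lty].
    - exact: measurable_tri.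
    - by move=> p [].
    - by apply: measurable_funS (measurable_within2 cphi) => [|p []//]; exact: measurable_square.
    - by move=> p tp; apply: phiM; case: tp.
    - move=> p tp ntr nN; rewrite /phi cutoff_ge ?mul0r// leNgt; apply/negP => lt.
      have [pt|pt] := leP p.1 t; first by apply: ntr; split.
      by apply: nN; split => //=; rewrite in_itv/= pt lt.
  rewrite ler_wpM2l// -lee_fin fineK ?fin_num_measure// gamma_fst// -lebN.
  by apply: le_measure; rewrite ?inE//; exact: measurableI.
have h2 : `|\int[leb]_(tau in I01) (cutoff t e tau * H tau) - \int[leb]_(tau in `[0, t]) H tau| <= M * e.
  rewrite (_ : \int[leb]_(tau in `[0, t]) H tau =
    \int[leb]_(tau in `[0, t]) (cutoff t e tau * H tau)); last first.
    apply: eq_Rintegral => tau /set_mem/=; rewrite in_itv/= => /andP[_ b].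
    by rewrite cutoff_le// mul1r.
  rewrite -[X in M * X]/(fine e%:E) -lebN; apply: Rintegral_cut => //.
  - by move=> x /=; rewrite in_itv/= => /andP[x0 xt]; apply/I01P; rewrite x0 (le_trans xt).
  - apply: measurable_funM => //; apply: measurable_funTS.
    have mc : measurable_fun setT (cutoff t e).
      by apply: continuous_measurable_fun; exact: continuous_cutoff.
    by move=> _ A mA; exact: (mc measurableT A mA).
  - move=> x Ix; rewrite normrM -[leRHS]mul1r.
    by apply: ler_pM => //; exact: HM'.
  - move=> x /I01P/andP[x0 x1] nx nN; rewrite cutoff_ge ?mul0r// leNgt; apply/negP => lt.
    have [xt|xt] := leP x t; first by apply: nx; rewrite /= in_itv/= x0.
    by apply: nN => /=; rewrite in_itv/= xt lt.
have E : \int[leb]_(tau in I01) (cutoff t e tau * H tau) =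
    \int[gamma]_(p in triangle) phi p.
  rewrite phiE; apply: eq_Rintegral => tau /set_mem Itau.
  rewrite /phi/= RintegralZl//.
  by apply: (integrable_bdd (M := M)) => //; exact: nufin.
rewrite E in h2.
have -> : e' = 2 * (M * e) + e.
  by rewrite /e; field; rewrite gt_eqF.
rewrite -(subrKA (\int[gamma]_(p in triangle) phi p)).
apply: le_trans (ler_normD _ _) _; rewrite distrC.
by lra.
Qed.

End disintegrations.

(** * Convergence on slabs *)

(** The arithmetic of the induction in [slab_cvg_triangle]. [A], [B] and [C], [D] are the integrals
    of phi up to the right and left ends of a slab for the two measures; [P1], [P2] and [Q1], [Q2]
    are the same integrals with phi frozen in tau. *)
Lemma ler_dist_slab (R : realType) (A B C D P1 P2 Q1 Q2 x y z u v : R) :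
  `|(A - B) - (P1 - P2)| <= x -> `|(C - D) - (Q1 - Q2)| <= y ->
  `|P1 - Q1| <= u -> `|P2 - Q2| <= v -> `|B - D| <= z ->
  `|A - C| <= z + x + y + u + v.
Proof.
rewrite !ler_norml => /andP[? ?] /andP[? ?] /andP[? ?] /andP[? ?] /andP[? ?].
by apply/andP; split; lra.
Qed.

Section weak_convergence.
Context (R : realType).
Implicit Types (gamma : probability (R * R)%type R).

(** Exactly the integrals that enter the equation of motion. The filter is a parameter: density uses
    [\oo], compactness an ultrafilter. *)
Definition slab_cvg (U : set_system nat)
    (gn : nat -> probability (R * R)%type R) gamma :=
  forall t, I01 t -> forall psi : R -> R, {within I01, continuous psi} ->
    \int[gn n]_(p in tri t) psi p.2 @[n --> U] -->
    \int[gamma]_(p in tri t) psi p.2.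

Variables (U : set_system nat) (gn : nat -> probability (R * R)%type R).
Variable (gamma : probability (R * R)%type R).
Context {FU : ProperFilter U}.
Hypothesis gnG : forall n, Gamma (gn n).
Hypothesis gG : Gamma gamma.
Hypothesis gcvg : slab_cvg U gn gamma.

(** The integrals are M-Lipschitz in t with M independent of n, so pointwise convergence on the
    compact interval is uniform. *)
Lemma slab_cvg_uniform (psi : R -> R) (e : R) :
  {within I01, continuous psi} -> 0 < e ->
  \forall n \near U, forall t, I01 t ->
    `|\int[gn n]_(p in tri t) psi p.2 - \int[gamma]_(p in tri t) psi p.2| < e.
Proof.
move=> cpsi e0.
have [M M0 HM] := compact_bdd (@compact_I01 R) cpsi.
have /compact_near_coveringP/near_covering_withinP cov := @compact_I01 R.
apply: cov => t It.
(* Moving t by less than r changes each of the two integrals by at most e / 4; the remaining e / 2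
   is for convergence at the centre of the ball. *)
pose r := e / (4 * (M + 1)).
have r0 : 0 < r by rewrite divr_gt0//; lra.
have e20 : 0 < e / 2 by rewrite divr_gt0.
have /cvgrPdist_lt/(_ _ e20) ct := gcvg It cpsi.
have lip g' : Gamma g' -> forall a b, I01 a -> I01 b ->
    `|\int[g']_(p in tri a) psi p.2 - \int[g']_(p in tri b) psi p.2| <= M * `|a - b|.
  move=> g'G; have H a b : I01 a -> I01 b -> a <= b ->
      `|\int[g']_(p in tri b) psi p.2 - \int[g']_(p in tri a) psi p.2| <= M * (b - a).
    move=> /I01P/andP[a0 _] /I01P/andP[_ b1] ab.
    apply: tri_slab_bdd => //; first exact: integrable_tri.
    by move=> p [/tri_snd Ip _]; exact: HM.
  move=> a b Ia Ib; have [ab|/ltW ba] := leP a b.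
    by rewrite distrC [`|a - b|]distrC [`|b - a|]ger0_norm ?subr_ge0// H.
  by rewrite [`|a - b|]ger0_norm ?subr_ge0// H.
exists (ball t r, [set n | `|\int[gamma]_(p in tri t) psi p.2 -
   \int[gn n]_(p in tri t) psi p.2| < e / 2]) => /=.
  by split; [exact: nbhsx_ballx|exact: ct].
move=> [s n]/= [st hn] Is.
have h1 := lip _ (gnG n) _ _ Is It; have h2 := lip _ gG _ _ It Is.
have h3 : M * `|t - s| <= e / 4.
  apply: (@le_trans _ _ ((M + 1) * r)); last first.
    rewrite (_ : (M + 1) * r = e / 4)// /r; field.
    by rewrite gt_eqF//; lra.
  by rewrite ler_pM// ?lerDl// ltW.
rewrite (distrC s t) in h1.
move: h1 h2 hn h3; rewrite !ler_norml !ltr_norml.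
by move=> /andP[? ?] /andP[? ?] /andP[? ?] ?; apply/andP; split; lra.
Qed.

(* On a thin slab [a < t <= b] the integrand [phi (t, s)] is close to
   [phi (b, s)], a function of [s] alone. *)
Lemma slab_cvg_triangle (phi : R * R -> R) : {within triangle, continuous phi} ->
  \int[gn n]_(p in triangle) phi p @[n --> U] --> \int[gamma]_(p in triangle) phi p.
Proof.
move=> cphi; apply/cvgrPdist_le => e e0.
have mT := @measurable_triangle R.
have mphi := measurable_within_prod mT cphi.
have [M M0 HM] := compact_bdd (@compact_triangle R) cphi.
have iphi (g' : probability (R * R)%type R) t : g'.-integrable (tri t) (EFin \o phi).
  apply: (integrable_bdd (M := M)) => //.
  - exact: measurable_tri.
  - by apply: gamma_lty; exact: measurable_tri.
  - by apply: measurable_funS mphi => // p [].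
  - by move=> p [tp _]; exact: HM.
have e30 : 0 < e / 3 by lra.
have [r r0 Hr] := compact_unif_cont (@compact_triangle R) (@subset_refl _ _) cphi e30.
pose m := (Num.truncn r^-1).+1.
have m0 : 0 < m%:R :> R by rewrite ltr0n.
have mr : m%:R^-1 < r.
  by rewrite invf_plt// ?posrE//; exact: truncnS_gt.
pose a i : R := i%:R / m%:R.
have aS i : a i.+1 - a i = m%:R^-1 by rewrite /a -mulrBl -natrB// subSnn mul1r.
have a_ge0 i : 0 <= a i by rewrite divr_ge0.
have a_le1 i : (i <= m)%N -> a i <= 1 by move=> im; rewrite ler_pdivrMr// mul1r ler_nat.
have a_le i : a i <= a i.+1 by rewrite -subr_ge0 aS invr_ge0.
have a_I i : (i <= m)%N -> I01 (a i) by move=> im; apply/I01P; rewrite a_ge0 a_le1.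
have cpsi i : (i <= m)%N -> {within I01, continuous (fun s => phi (a i, Num.min s (a i)))}.
  move=> im; apply/subspace_continuousP => s Is.
  have tri_i x : I01 x -> triangle (a i, Num.min x (a i)).
    move=> /I01P/andP[x0 x1]; apply/triangleP; split => /=.
    - by rewrite le_min x0 a_ge0.
    - by rewrite ge_min lexx orbT.
    - exact: a_le1.
  have /subspace_continuousP/(_ _ (tri_i s Is)) := cphi.
  apply: (cvg_comp (fun x => (a i, Num.min x (a i))) phi) => A /= [[V W] /= [Va Ws] VW].
  have cmin : continuous (fun x : R => Num.min x (a i)).
    by move=> x; apply: (@continuous_min _ _ (@id R) (cst (a i)));
      [exact: cvg_id|exact: cvg_cst].
  have HW : \forall y \near s, W (Num.min y (a i)) := cmin s W Ws.
  change (\forall y \near s, I01 y -> A (a i, Num.min y (a i))).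
  near=> y => Iy; apply: (VW (a i, Num.min y (a i))); last exact: tri_i.
  by split => /=; [exact: nbhs_singleton Va|near: y; exact: HW].
(* The tolerance grows by e / m per slab: e / 3 / m for freezing tau under each of the two measures,
   e / 6 / m for convergence at each end. *)
have main i : (i <= m)%N -> \forall n \near U,
    `|\int[gamma]_(p in tri (a i)) phi p - \int[gn n]_(p in tri (a i)) phi p| <= e * a i.
  elim: i => [_|i IH im].
    near=> n; rewrite /a mul0r mulr0.
    have z (g' : probability (R * R)%type R) : Gamma g' -> \int[g']_(p in tri 0) phi p = 0.
      move=> g'G; apply/eqP; rewrite -normr_le0.
      have g0 : fine (g' (tri (0:R))) = 0 by rewrite gamma_tri//; exact: I010.
      apply: (@le_trans _ _ (M * fine (g' (tri 0)))); last by rewrite g0 mulr0.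
      apply: Rintegral_bdd => //.
      - exact: measurable_tri.
      - by apply: gamma_lty; exact: measurable_tri.
      - exact/measurable_EFinP/measurable_int/(iphi g' 0).
      - by move=> p [tp _]; exact: HM.
    by rewrite !z// subrr normr0.
  have im' := ltnW im.
  pose psi s := phi (a i.+1, Num.min s (a i.+1)).
  have cps : {within I01, continuous psi} := cpsi _ im.
  have e60 : 0 < e / 6 / m%:R by rewrite divr_gt0//; lra.
  have /cvgrPdist_lt/(_ _ e60) c1 := gcvg (a_I _ im) cps.
  have /cvgrPdist_lt/(_ _ e60) c2 := gcvg (a_I _ im') cps.
  have slab (g' : probability (R * R)%type R) : Gamma g' ->
      `|(\int[g']_(p in tri (a i.+1)) phi p - \int[g']_(p in tri (a i)) phi p) -
        (\int[g']_(p in tri (a i.+1)) psi p.2 - \int[g']_(p in tri (a i)) psi p.2)|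
      <= e / 3 / m%:R.
    move=> g'G.
    have ips t := integrable_tri g' t cps.
    have [ma mb] := (measurable_tri (a i), measurable_tri (a i.+1)).
    rewrite (Rintegral_setD ma mb (tri_sub (a_le i)) (iphi g' _)).
    rewrite (Rintegral_setD ma mb (tri_sub (a_le i)) (ips _)).
    rewrite (addrC (Rintegral _ _ phi)) addrK (addrC (Rintegral _ (tri (a i)) _)) addrK.
    have mba := measurableD mb ma.
    have -> : m%:R^-1 = fine (g' (tri (a i.+1) `\` tri (a i))).
      by rewrite gamma_slab// ?a_le1//= aS.
    apply: Rintegral_dist => //.
    - exact: gamma_lty.
    - by apply: integrableS (iphi g' (a i.+1)) => //; exact: subDsetl.
    - by apply: integrableS (ips (a i.+1)) => //; exact: subDsetl.
    - move=> p [[tp /= pb] npa]; apply/ltW; rewrite /psi.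
      have pa : a i < p.1 by rewrite ltNge; apply/negP => pa; apply: npa.
      have /triangleP[p0 p21 p1] := tp.
      have pm : Num.min p.2 (a i.+1) = p.2 by apply/min_idPl; exact: le_trans pb.
      rewrite pm; apply: Hr => //.
        by apply/triangleP; split => //=; [exact: le_trans pb|exact: a_le1].
      split => /=; last exact: ballxx.
      rewrite /ball/= distrC ger0_norm ?subr_ge0//; apply: le_lt_trans mr.
      by rewrite -(aS i) lerB// ltW.
  have := IH im'; apply: filterS3 c1 c2 => n; rewrite -/psi => d1 d2 IHn.
  have s1 := slab _ gG; have s2 := slab _ (gnG n).
  have -> : e * a i.+1 = e * a i + e / 3 / m%:R + e / 3 / m%:R + e / 6 / m%:R + e / 6 / m%:R.
    rewrite (_ : a i.+1 = a i + m%:R^-1); last by rewrite -(aS i); ring.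
    by field; rewrite gt_eqF.
  exact: (ler_dist_slab s1 s2 (ltW d1) (ltW d2) IHn).
have := main m (leqnn m); rewrite /a divff ?gt_eqF// mulr1 tri1.
exact.
Unshelve. all: by end_near. Qed.

End weak_convergence.

(** * Continuity of the cost *)

Section trajectories.
Context (R : realType) (d : nat).
Variables (x0 : 'rV[R]_d) (f : R -> 'rV[R]_d -> 'rV[R]_d).
Hypothesis f_cont : {within I01 `*` [set: 'rV[R]_d],
  continuous (fun p : R * 'rV[R]_d => f p.1 p.2)}.
Variable k : R.
Hypothesis k_ge0 : 0 <= k.
Hypothesis f_lip : forall t, I01 t -> forall x y : 'rV[R]_d,
  norm2 (f t x - f t y) <= k * norm2 (x - y).
(** With no disintegration at hand [traj] would fall back to the constant [x0].
    [disintegration_exists] discharges this by an argument in which no trajectory appears. *)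
Hypothesis disintegrable : forall gamma : probability (R * R)%type R,
  Gamma gamma -> exists nu, disintegration gamma nu.

(** A Lipschitz constant for bounds by coordinates: the Euclidean norm is at most d times the
    largest coordinate. The summand 1 makes it positive even if k = 0. *)
Let K := k * d%:R + 1.

Let K0 : 0 < K.
Proof. by rewrite ltr_pwDr// mulr_ge0. Qed.

Lemma norm2_ge (v : 'rV[R]_d) i : `|v 0 i| <= norm2 v.
Proof.
rewrite -sqrtr_sqr ler_sqrt; last by apply: sumr_ge0 => j _; exact: sqr_ge0.
by rewrite (bigD1 i)//= lerDl sumr_ge0// => j _; exact: sqr_ge0.
Qed.

Lemma norm2_le (v : 'rV[R]_d) (r : R) : 0 <= r -> (forall i, `|v 0 i| <= r) ->
  norm2 v <= d%:R * r.
Proof.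
move=> r0 vr; have dr0 : 0 <= d%:R * r by rewrite mulr_ge0.
rewrite -[leRHS](ger0_norm dr0) -sqrtr_sqr ler_wsqrtr//.
apply: (@le_trans _ _ (\sum_(i < d) r ^+ 2)).
  by apply: ler_sum => i _; rewrite -real_normK ?num_real// lerXn2r ?nnegrE.
rewrite sumr_const card_ord exprMn -[leLHS]mulr_natl ler_wpM2r ?sqr_ge0//.
by rewrite -natrX ler_nat; case: (d) => // n; rewrite expnS leq_pmulr// expn_gt0.
Qed.

Lemma vfield_lip s : I01 s -> forall (y z : 'rV[R]_d) (r : R),
  (forall i, `|y 0 i - z 0 i| <= r) ->
  forall i, `|f s y 0 i - f s z 0 i| <= K * r.
Proof.
move=> Is y z r yzr i; have r0 : 0 <= r := le_trans (normr_ge0 _) (yzr i).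
apply: (@le_trans _ _ (norm2 (f s y - f s z))).
  by have := norm2_ge (f s y - f s z) i; rewrite !mxE.
apply: le_trans (f_lip Is y z) _.
apply: (@le_trans _ _ (k * (d%:R * r))); last by rewrite /K mulrDl mul1r mulrA lerDl.
by rewrite ler_wpM2l// norm2_le// => l; rewrite !mxE.
Qed.

(** The Picard solution shows that the choice in [traj] is not made from an empty set. The chosen
    curve may come with another disintegration, but [disintegration_tri] sends every disintegration
    to the same equation. *)
Lemma traj_inteq gamma : Gamma gamma -> inteq x0 f gamma (traj x0 f gamma).
Proof.
move=> gG; have [x [cx xE]] := picard K0 vfield_lip f_cont x0 gG.
have [nu dnu] := disintegrable gG.
have ex : exists y, [set x | exists2 nu, disintegration gamma nu & solution x0 f nu x] y.
  exists x; exists nu => //; split; first exact/coord_contP.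
  move=> t It i; rewrite xE//; congr (_ + _).
  by rewrite -(disintegration_tri gG dnu (within_vfield f_cont cx (i := i)) It).
rewrite /traj; have [nu' dnu' [/coord_contP cy yE]] := xgetPex (cst x0) ex.
split => // t It i; rewrite yE//; congr (_ + _).
by rewrite (disintegration_tri gG dnu' (within_vfield f_cont cy (i := i)) It).
Qed.

Variables (U : set_system nat) (gn : nat -> probability (R * R)%type R).
Variable (gamma : probability (R * R)%type R).
Context {FU : ProperFilter U}.
Hypothesis gnG : forall n, Gamma (gn n).
Hypothesis gG : Gamma gamma.
Hypothesis gcvg : slab_cvg U gn gamma.

Lemma traj_cvg (e : R) : 0 < e -> \forall n \near U, forall t, I01 t -> forall i,
  `|traj x0 f (gn n) t 0 i - traj x0 f gamma t 0 i| < e.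
Proof.
move=> e0; set x := traj x0 f gamma.
have [cx xE] := traj_inteq gG.
pose A := e / (4 * expR (2 * K)).
have E0 := expR_gt0 (2 * K).
have A0 : 0 < A by rewrite divr_gt0// mulr_gt0.
have near_i (i : 'I_d) : \forall n \near U, forall t, I01 t ->
    `|\int[gn n]_(p in tri t) f p.2 (x p.2) 0 i -
      \int[gamma]_(p in tri t) f p.2 (x p.2) 0 i| < A.
  apply: (slab_cvg_uniform gnG gG gcvg (psi := fun s => f s (x s) 0 i)) => //.
  exact: within_vfield.
near=> n => t It i.
have Hn : forall i, forall t, I01 t ->
    `|\int[gn n]_(p in tri t) f p.2 (x p.2) 0 i -
      \int[gamma]_(p in tri t) f p.2 (x p.2) 0 i| < A.
  by near: n; exact: filter_forall.
(* The comparison runs along the limit trajectory, so the test function f s (x s) does not vary with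
   n. *)
have := gronwall K0 vfield_lip f_cont (gnG n) (ltW A0) (traj_inteq (gnG n))
  (traj_inteq gG) (fun t It i => ltW (Hn i t It)) It i.
move=> h; apply: le_lt_trans h _.
have -> : 2 * A * expR (2 * K) = e / 2 by rewrite /A; field; rewrite gt_eqF.
by lra.
Unshelve. all: by end_near. Qed.

Lemma J_cvg (j : R -> 'rV[R]_d -> R) (h : 'rV[R]_d -> R) (g : R -> R -> R) :
  {within I01 `*` [set: 'rV[R]_d],
     continuous (fun p : R * 'rV[R]_d => j p.1 p.2)} ->
  continuous h ->
  {within triangle, continuous (fun p : R * R => g p.1 p.2)} ->
  J x0 f j h g (gn n) @[n --> U] --> J x0 f j h g gamma.
Proof.
move=> cj ch cg; set x := traj x0 f gamma.
have [cx _] := traj_inteq gG.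
have lebI : @lebesgue_measure R I01 = 1%E.
  by rewrite lebesgue_measure_itv/= lte_fin ltr01 oppr0 adde0.
have lebIfin : (@lebesgue_measure R I01 < +oo)%E by rewrite lebI ltry.
apply: cvgD; last exact: (slab_cvg_triangle gnG gG gcvg cg).
apply: cvgD.
  have jint y : coord_cont y ->
      (@lebesgue_measure R).-integrable I01 (EFin \o (fun t => j t (y t))).
    move=> cy; apply: continuous_compact_integrable; first exact: compact_I01.
    exact: (within_graph (phi := fun p => j p.1 p.2) cj cy).
  apply/cvgrPdist_le => e e0.
  (* j need not be uniformly continuous on the whole product, but it is so around this compact
     graph. *)
  pose graph := (fun t => (t, x t)) @` I01.
  have cgraph : compact graph.
    apply: continuous_compact; last exact: compact_I01.
    have /coord_contP/subspace_continuousP cx' := cx.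
    apply/subspace_continuousP => t It; apply/cvg_ballP => e1 e10.
    near=> s; split => /=.
      by near: s; apply: cvg_within; exact: nbhsx_ballx.
    by near: s; have /cvg_ballP/(_ _ e10) := cx' t It.
  have graphD : graph `<=` I01 `*` [set: 'rV[R]_d] by move=> _ [t It <-].
  have [r r0 Hr] := compact_unif_cont cgraph graphD cj e0.
  apply: filterS (traj_cvg r0) => n Hn.
  have [cxn _] := traj_inteq (gnG n).
  rewrite -[e]mulr1 (_ : 1 = fine (@lebesgue_measure R I01)); last by rewrite lebI.
  apply: Rintegral_dist.
  - exact: measurable_I01.
  - exact: lebIfin.
  - exact: jint.
  - exact: jint.
  - move=> t It; apply/ltW; apply: (Hr (t, x t) (t, traj x0 f (gn n) t)).
    + by exists t.
    + by [].
    + split => /=; first exact: ballxx.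
      by split => // a i; rewrite (ord1 a) /ball/= distrC; exact: Hn.
apply: (cvg_comp (fun n => traj x0 f (gn n) 1) h); last exact: ch.
apply/cvg_ballP => e e0; apply: filterS (traj_cvg e0) => n Hn.
by split => // a i; rewrite (ord1 a) /ball/= distrC; apply: Hn; exact: I011.
Unshelve. all: by end_near. Qed.

End trajectories.

(** * Measures with interlacing distribution functions; quantiles *)

(* [b i] can be either [s < q i] or [s <= q i]. *)
Lemma abel_step (R : realType) (psi q : nat -> R) (psis s w : R)
    (b : nat -> bool) (m : nat) :
  {homo q : i j / (i < j)%N >-> i < j} -> q 0%N <= s ->
  (forall i, s < q i -> b i) -> (forall i, q i < s -> ~~ b i) ->
  (forall i, (i < m)%N -> q i <= s <= q i.+1 -> `|psi i - psis| <= w) ->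
  (forall i, (i < m)%N -> q i <= s <= q i.+1 -> `|psi i.+1 - psis| <= w) ->
  forall k, (k <= m)%N ->
    let S := psi k - \sum_(i < k) (psi i.+1 - psi i) * (b i)%:R in
    (q k <= s -> S = psi k) /\ (s < q k -> `|S - psis| <= w).
Proof.
move=> qS q0 bT bF H1 H2; elim=> [_|k IH km] /=.
  by rewrite big_ord0 subr0; split=> // h; have := lt_le_trans h q0; rewrite ltxx.
have [IH1 IH2] := IH (ltnW km).
rewrite big_ord_recr/=.
set T := \sum_(i < k) _ in IH1 IH2 *.
have qk : q k < q k.+1 by exact: qS.
split=> h.
  have qks : q k < s by exact: lt_le_trans h.
  rewrite (negbTE (bF _ qks)) mulr0 addr0.
  by have := IH1 (ltW qks) => ?; lra.
have [ks|sk] := leP (q k) s.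
  have T0 : T = 0 by have := IH1 ks => ?; lra.
  rewrite T0 add0r; case: (b k); rewrite ?mulr1 ?mulr0.
    by rewrite opprB addrCA subrr addr0; apply: H1 => //; rewrite ks ltW.
  by rewrite subr0; apply: H2 => //; rewrite ks ltW.
rewrite bT// mulr1.
have -> : psi k.+1 - (T + (psi k.+1 - psi k)) - psis = psi k - T - psis by ring.
exact: IH2.
Qed.

Section sandwich.
Context (R : realType) d (T : measurableType d).
Variables (mu : {measure set T -> \bar R}) (D : set T) (s : T -> R).
Hypothesis mD : measurable D.
Hypothesis Dfin : (mu D < +oo)%E.

Lemma Rintegral_steps (c : R) (a : nat -> R) (B : nat -> set T) k :
  (forall i, measurable (B i)) ->
  mu.-integrable D (EFin \o (fun x => c - \sum_(i < k) a i * (x \in B i)%:R)) /\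
  \int[mu]_(x in D) (c - \sum_(i < k) a i * (x \in B i)%:R) =
  c * fine (mu D) - \sum_(i < k) a i * fine (mu (D `&` B i)).
Proof.
move=> mB; elim: k => [|k [IHi IHE]].
  under eq_fun do rewrite big_ord0 subr0.
  rewrite big_ord0 subr0 -Rintegral_cst//; split=> //.
  by apply: (integrable_bdd (M := `|c|)) => //; exact: measurable_cst.
have E x : c - \sum_(i < k.+1) a i * (x \in B i)%:R =
    (c - \sum_(i < k) a i * (x \in B i)%:R) - a k * \1_(B k) x.
  by rewrite big_ord_recr/= opprD addrA indicE.
have i1 : mu.-integrable D (EFin \o (fun x => a k * \1_(B k) x)).
  apply: (integrable_bdd (M := `|a k|)) => //.
    by apply: measurable_funM; [exact: measurable_cst|exact: measurable_indic].
  move=> x _; rewrite normrM indicE; case: (x \in B k); rewrite ?normr1 ?normr0 ?mulr1//.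
  by rewrite mulr0.
have i2 : mu.-integrable D (EFin \o \1_(B k)).
  apply: (integrable_bdd (M := 1)) => //.
  by move=> x _; rewrite indicE; case: (x \in B k); rewrite ?normr1 ?normr0.
under eq_fun do rewrite E.
split; first by have := integrableB mD IHi i1.
rewrite RintegralB// IHE big_ord_recr/= opprD addrA; congr (_ - _).
rewrite RintegralZl//; congr (_ * _).
by rewrite /Rintegral integral_indic// setIC.
Qed.

(** Abel summation: psi 1 minus the increments of psi over the nodes above s is the value of psi at
    a node next to s. Up to the oscillation w, the integral is therefore a function of the masses of
    the sets [B i], whichever way these treat the level q i itself. *)
Lemma Rintegral_abel (psi : R -> R) (q : nat -> R) (m : nat) (w : R)
    (B : nat -> set T) :
  (0 < m)%N -> (forall i, measurable (B i)) ->
  mu.-integrable D (EFin \o (psi \o s)) ->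
  {homo q : i j / (i < j)%N >-> i < j} -> q 0%N = 0 -> q m = 1 ->
  (forall x, D x -> 0 <= s x <= 1) ->
  (forall x i, D x -> s x < q i -> B i x) ->
  (forall x i, D x -> q i < s x -> ~ B i x) ->
  (forall x y i, (i < m)%N -> q i <= x <= q i.+1 -> q i <= y <= q i.+1 ->
     `|psi x - psi y| <= w) ->
  `|\int[mu]_(x in D) psi (s x) - (psi 1 * fine (mu D) -
     \sum_(i < m) (psi (q i.+1) - psi (q i)) * fine (mu (D `&` B i)))|
   <= w * fine (mu D).
Proof.
move=> m0 mB ipsi qS q0 qm sI BT BF Hw.
have [ist <-] := Rintegral_steps (psi 1) (fun i => psi (q i.+1) - psi (q i)) m mB.
apply: Rintegral_dist => // x Dx; rewrite distrC.
have q_le i : q i <= q i.+1 by apply: ltW; exact: qS.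
have w0 : 0 <= w.
  by have := Hw (q 0%N) (q 0%N) 0%N m0; rewrite lexx q_le subrr normr0; apply.
have /andP[s0 s1] := sI x Dx.
have [|||||h1 h2] := @abel_step R (psi \o q) q (psi (s x)) (s x) w
  (fun i => x \in B i) m qS _ _ _ _ _ m (leqnn m).
- by rewrite q0.
- by move=> i h; apply/mem_set; exact: BT.
- by move=> i h; apply/negP => /set_mem; exact: BF.
- by move=> i im h; apply: (Hw _ _ i) => //; rewrite lexx q_le.
- by move=> i im h; apply: (Hw _ _ i) => //; rewrite lexx q_le.
- have -> : psi 1 = psi (q m) by rewrite qm.
  have [sq|sq] := ltP (s x) (q m); first exact: h2.
  rewrite h1//; have -> : s x = q m by apply/eqP; rewrite eq_le sq andbT qm s1.
  by rewrite /= subrr normr0.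
Qed.

End sandwich.

(** By interlacing, the gaps H i - H' i occupy disjoint parts of [0, L] and sum to at most L, so the
    bound does not grow with the number of nodes. *)
Lemma ler_norm_sandwich (R : realType) (a H H' : nat -> R) (w L : R) m :
  (0 < m)%N -> (forall i, (i < m)%N -> `|a i| <= w) ->
  0 <= H' 0%N -> (forall i, H' i <= H i) -> (forall i, H i <= H' i.+1) ->
  (forall i, H i <= L) ->
  `|\sum_(i < m) a i * (H i - H' i)| <= w * L.
Proof.
move=> m0 aw H0 H1 H2 HL.
have w0 : 0 <= w := le_trans (normr_ge0 _) (aw 0%N m0).
apply: (@le_trans _ _ (w * \sum_(i < m) (H i - H' i))).
  apply: le_trans (ler_norm_sum _ _ _) _.
  rewrite mulr_sumr; apply: ler_sum => i _.
  by rewrite normrM [`|H i - _|]ger0_norm ?subr_ge0// ler_wpM2r ?subr_ge0// aw.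
rewrite ler_wpM2l//.
have : forall k, \sum_(i < k.+1) (H i - H' i) <= H k.
  elim=> [|k IH]; first by rewrite big_ord_recr big_ord0/= add0r gerBl.
  rewrite big_ord_recr/=; have := H2 k; move: IH.
  by set S := \sum_(i < _) _; move=> ? ?; lra.
by move=> /(_ m.-1); rewrite prednK// => h; apply: le_trans h _.
Qed.

Section quantile.
Context (R : realType) d (T : measurableType d).
Variables (tau : T -> R) (E : rat -> set T).

(* The point [tau x] caps the quantile and keeps the set non-empty, so that
   [inf] never takes its junk value. *)
Definition quantile (x : T) : R :=
  inf ([set tau x] `|` [set ratr q | q in [set q : rat | 0 <= q /\ E q x]]).

(** The Galois connection of a generalised inverse, in strict form because the infimum need not be
    attained. All other facts about [quantile] follow from it; rational levels make its sublevel
    sets countable unions. *)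
Lemma quantile_lt x y : quantile x < y <->
  tau x < y \/ exists q, [/\ 0 <= q, E q x & ratr q < y].
Proof.
rewrite /quantile; set S := _ `|` _.
have S0 : S !=set0 by exists (tau x); left.
have Slb : has_lbound S.
  exists (Num.min 0 (tau x)) => _ [->|[q [q0 _] <-]]; first by rewrite ge_min lexx orbT.
  by rewrite ge_min ler0q q0.
split.
  move=> /(inf_lt S0)[_ [->|[q [q0 Eq] <-]] h]; first by left.
  by right; exists q.
move=> [h|[q [q0 Eq h]]]; apply: le_lt_trans h; apply: ge_inf => //.
  by left.
by right; exists q.
Qed.

Lemma quantile_le x : quantile x <= tau x.
Proof.
apply/ler_addgt0Pr => e e0; apply/ltW/quantile_lt; left.
by rewrite ltrDl.
Qed.

Lemma quantile_ge0 x : 0 <= tau x -> 0 <= quantile x.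
Proof.
move=> t0; rewrite leNgt; apply/negP => /quantile_lt[|[q [q0 _]]].
  by rewrite ltNge t0.
by rewrite ltNge ler0q q0.
Qed.

Lemma measurable_quantile : measurable_fun setT tau ->
  (forall q, measurable (E q)) -> measurable_fun setT quantile.
Proof.
move=> mtau mE; apply: (measurability _ (RGenInftyO.measurableE R)).
move=> _ [_ [y ->] <-]; rewrite setTI.
have -> : quantile @^-1` `]-oo, y[ = tau @^-1` `]-oo, y[ `|`
    \bigcup_q (if (0 <= q) && (ratr q < y) then E q else set0).
  apply/seteqP; split => x /=.
    rewrite in_itv/= => /quantile_lt[h|[q [q0 Eq qy]]].
      by left; rewrite in_itv.
    by right; exists q => //; rewrite q0 qy.
  rewrite !in_itv/= => -[h|[q _]]; first by apply/quantile_lt; left.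
  by case: ifPn => // /andP[q0 qy] Eq; apply/quantile_lt; right; exists q.
apply: measurableU; first by rewrite -[X in measurable X]setTI; exact: mtau.
apply: countable_bigcupT_measurable => [|q]; first exact: countableP.
by case: ifP => _ //; exact: measurable0.
Qed.

End quantile.

Lemma mesh_lt (R : realType) (r : R) : 0 < r ->
  exists m, (0 < m)%N /\ m%:R^-1 < r.
Proof.
move=> r0; exists (Num.truncn r^-1).+1; split => //.
by rewrite invf_plt// ?posrE//; exact: truncnS_gt.
Qed.

Section sandwich_limit.
Context (R : realType) (D : set (R * R)).
Hypothesis mD : measurable D.
Hypothesis D2 : forall p, D p -> I01 p.2.

Let below (q : R) : set (R * R) := [set p | p.2 < q].
Let upto (q : R) : set (R * R) := [set p | p.2 <= q].

Lemma measurable_below q : measurable (below q).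
Proof.
have -> : below q = snd @^-1` `]-oo, q[%classic.
  by apply/seteqP; split => p /=; rewrite in_itv.
exact: measurable_snd_preimage.
Qed.

Lemma measurable_upto q : measurable (upto q).
Proof.
have -> : upto q = snd @^-1` `]-oo, q]%classic.
  by apply/seteqP; split => p /=; rewrite in_itv.
exact: measurable_snd_preimage.
Qed.

(** At an atom the limit [H] may differ from the distribution function of [gamma], hence only
    interlacing between strict sublevels is assumed. Step approximation for [gamma] and for [gn n],
    the sandwich, and convergence at the nodes cost e / 5 each. *)
Lemma sandwich_cvg (U : set_system nat) (FU : ProperFilter U)
    (gn : nat -> probability (R * R)%type R) (gamma : probability (R * R)%type R)
    (L : R) (H : rat -> R) :
  (forall n, gn n D = L%:E) -> gamma D = L%:E ->
  (forall q, 0 <= q -> fine (gn n (D `&` upto (ratr q))) @[n --> U] --> H q) ->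
  (forall q, 0 <= q -> fine (gamma (D `&` below (ratr q))) <= H q) ->
  (forall q r, 0 <= q -> q < r -> H q <= fine (gamma (D `&` below (ratr r)))) ->
  forall psi : R -> R, {within I01, continuous psi} ->
  \int[gn n]_(p in D) psi p.2 @[n --> U] --> \int[gamma]_(p in D) psi p.2.
Proof.
move=> gnL gL HU Hle Hge psi cpsi; apply/cvgrPdist_le => e e0.
have L0 : 0 <= L by rewrite -lee_fin -gL.
have L1 : L <= 1 by rewrite -lee_fin -gL probability_le1.
have lty (g' : probability (R * R)%type R) A : measurable A -> (g' A < +oo)%E.
  by move=> mA; exact: gamma_lty.
have ffin (g' : probability (R * R)%type R) A : measurable A -> g' A \is a fin_num.
  by move=> mA; exact: fin_num_measure.
have [M M0 HM] := compact_bdd (@compact_I01 R) cpsi.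
have ipsi (g' : probability (R * R)%type R) : g'.-integrable D (EFin \o (psi \o snd)).
  apply: (integrable_bdd (M := M)) => //; first exact: lty.
    by apply: (measurable_snd_fun (psi := psi)) => //; exact: measurable_within1.
  by move=> p /D2; exact: HM.
have e50 : 0 < e / 5 by lra.
have [r r0 Hr] := compact_unif_cont (@compact_I01 R) (@subset_refl _ _) cpsi e50.
have [m [m0 mr]] := mesh_lt r0.
have mR0 : 0 < m%:R :> R by rewrite ltr0n.
pose qq (i : nat) : rat := i%:R / m%:R.
pose q i : R := ratr (qq i).
have qE i : q i = i%:R / m%:R by rewrite /q fmorph_div/= !ratr_nat.
have qqS i j : (i < j)%N -> qq i < qq j.
  by move=> ij; rewrite ltr_pM2r ?invr_gt0 ?ltr0n// ltr_nat.
have qS i j : (i < j)%N -> q i < q j by move=> ij; rewrite ltr_rat qqS.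
have qq0 i : 0 <= qq i by rewrite divr_ge0.
have q0 : q 0%N = 0 by rewrite qE mul0r.
have qm : q m = 1 by rewrite qE divff ?gt_eqF.
have Iq i : (i <= m)%N -> I01 (q i).
  move=> im; apply/I01P; rewrite qE divr_ge0//=.
  by rewrite ler_pdivrMr// mul1r ler_nat.
have osc x y i : (i < m)%N -> q i <= x <= q i.+1 -> q i <= y <= q i.+1 ->
    `|psi x - psi y| <= e / 5.
  move=> im /andP[x1 x2] /andP[y1 y2]; apply/ltW.
  have /I01P/andP[a0 _] := Iq _ (ltnW im); have /I01P/andP[_ a1] := Iq _ im.
  apply: Hr.
  - by apply/I01P; apply/andP; split; [exact: le_trans x1|exact: le_trans a1].
  - by apply/I01P; apply/andP; split; [exact: le_trans y1|exact: le_trans a1].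
  - rewrite /ball/=; apply: le_lt_trans mr.
    have : q i.+1 - q i = m%:R^-1 by rewrite !qE -mulrBl -natrB// subSnn mul1r.
    by move=> <-; rewrite ler_norml; apply/andP; split; lra.
pose Dl i := psi (q i.+1) - psi (q i).
have Dle i : (i < m)%N -> `|Dl i| <= e / 5.
  have qi := ltW (qS i i.+1 (ltnSn i)).
  by move=> im; apply: (osc _ _ i) => //; rewrite ?lexx ?qi.
pose H' i := fine (gamma (D `&` below (q i))).
have key : `|\sum_(i < m) Dl i * (H (qq i) - H' i)| <= e / 5.
  apply: (@le_trans _ _ (e / 5 * L)); last by rewrite ler_piMr// ltW.
  apply: (@ler_norm_sandwich _ Dl (H \o qq) H') => //.
  - by apply: fine_ge0.
  - by move=> i; exact: Hle.
  - by move=> i; apply: Hge => //; exact: qqS.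
  - move=> i /=; apply: le_trans (Hge _ _ (qq0 i) (qqS i i.+1 (ltnSn i))) _.
    have mb : measurable (D `&` below (q i.+1)).
      by apply: measurableI => //; exact: measurable_below.
    by rewrite -lee_fin fineK ?ffin// -gL le_measure ?inE.
have I1 : `|\int[gamma]_(p in D) psi p.2 - (psi 1 * L - \sum_(i < m) Dl i * H' i)| <= e / 5 * L.
  have fg : fine (gamma D) = L by rewrite gL.
  rewrite -fg; apply: (Rintegral_abel mD (lty _ _ mD)
    (B := fun i => below (q i)) m0 _ (ipsi _) qS q0 qm) => //.
  - by move=> i; exact: measurable_below.
  - by move=> p i _ h /= h'; have := lt_trans h h'; rewrite ltxx.
have I2 n : `|\int[gn n]_(p in D) psi p.2 -
    (psi 1 * L - \sum_(i < m) Dl i * fine (gn n (D `&` upto (q i))))| <= e / 5 * L.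
  have fg : fine (gn n D) = L by rewrite gnL.
  rewrite -fg; apply: (Rintegral_abel mD (lty _ _ mD)
    (B := fun i => upto (q i)) m0 _ (ipsi _) qS q0 qm) => //.
  - by move=> i; exact: measurable_upto.
  - by move=> p i _ /ltW.
  - by move=> p i _ h /= h'; have := lt_le_trans h h'; rewrite ltxx.
have cS l : \sum_(i < l) Dl i * fine (gn n (D `&` upto (q i))) @[n --> U] -->
    \sum_(i < l) Dl i * H (qq i).
  elim: l => [|l IH].
    by under eq_fun do rewrite big_ord0; rewrite big_ord0; exact: cvg_cst.
  under eq_fun do rewrite big_ord_recr; rewrite big_ord_recr.
  by apply: cvgD => //; apply: cvgM; [exact: cvg_cst|exact: HU].
have /cvgrPdist_le/(_ _ e50) := cS m.
apply: filterS => n hn.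
have eL : e / 5 * L <= e / 5 by rewrite ler_piMr// ltW.
have I1' := le_trans I1 eL; have I2' := le_trans (I2 n) eL.
move: key hn I1' I2'.
under eq_bigr do rewrite mulrBr.
rewrite sumrB.
set S1 := \sum_(i < m) _; set S2 := \sum_(i < m) _; set S3 := \sum_(i < m) _.
set A := Rintegral _ _ _; set B := Rintegral _ _ _.
move: A B S1 S2 S3 (psi 1 * L) => A B S1 S2 S3 z; rewrite !ler_norml.
move=> /andP[? ?] /andP[? ?] /andP[? ?] /andP[? ?].
by apply/andP; split; lra.
Qed.

End sandwich_limit.

(** * Density of the measures carried by graphs *)

Section theta_approximation.
Context (R : realType).
Variable gamma : probability (R * R)%type R.
Hypothesis gG : Gamma gamma.
Variable m : nat.
Hypothesis m0 : (0 < m)%N.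
Local Notation leb := (@lebesgue_measure R).

Let a (i : nat) : R := i%:R / m%:R.
Let slab i := tri (a i.+1) `\` tri (a i).
Let c i (q : rat) := fine (gamma (slab i `&` [set p | p.2 <= ratr q])).
(** The times at which the increasing rearrangement should be at most q: in each slab, an initial
    interval as long as the mass that [gamma] puts there on s <= q. *)
Let E (q : rat) : set R := \bigcup_(i in `I_m) `]a i, (a i + c i q)%R[%classic.

Let mR0 : 0 < m%:R :> R. Proof. by rewrite ltr0n. Qed.

Let a0 i : 0 <= a i. Proof. by rewrite divr_ge0. Qed.

Let a_le i j : (i <= j)%N -> a i <= a j.
Proof. by move=> ij; rewrite ler_pM2r ?invr_gt0// ler_nat. Qed.

Let a1 i : (i <= m)%N -> a i <= 1.
Proof. by move=> im; rewrite ler_pdivrMr// mul1r ler_nat. Qed.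

Let aS i : a i.+1 - a i = m%:R^-1.
Proof. by rewrite /a -mulrBl -natrB// subSnn mul1r. Qed.

Let mslab i : measurable (slab i).
Proof. by apply: measurableD; exact: measurable_tri. Qed.

Let mslabq i q : measurable (slab i `&` [set p | p.2 <= ratr q]).
Proof. by apply: measurableI => //; exact: measurable_upto. Qed.

Let cE i q : (c i q)%:E = gamma (slab i `&` [set p | p.2 <= ratr q]).
Proof. by rewrite fineK// fin_num_measure. Qed.

Let c0 i q : 0 <= c i q. Proof. by rewrite fine_ge0. Qed.

Let c_le i q r : q <= r -> c i q <= c i r.
Proof.
move=> qr; rewrite -lee_fin !cE; apply: le_measure; rewrite ?inE//.
by move=> p [sp /= pq]; split => //=; apply: le_trans pq _; rewrite ler_rat.
Qed.

Let c_slab i q : (i < m)%N -> a i + c i q <= a i.+1.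
Proof.
move=> im; rewrite -lerBrDl -lee_fin cE.
rewrite -(gamma_slab gG (a0 i) (a_le (leqnSn i)) (a1 im)).
apply: le_measure; rewrite ?inE//; exact: mslab.
Qed.

Let mE q : measurable (E q).
Proof. by apply: bigcup_measurable => i _; exact: measurable_itv. Qed.

Let E_slab i q t : (i < m)%N -> a i < t -> t <= a i.+1 -> E q t ->
  t < a i + c i q.
Proof.
move=> im ait tai [l /= lm]; rewrite in_itv/= => /andP[alt tal].
have [li|il|<-//] := ltngtP l i.
  have := lt_le_trans tal (c_slab q lm).
  by rewrite ltNge (le_trans (a_le li))// ltW.
by have := le_lt_trans (a_le il) alt; rewrite ltNge tai.
Qed.

Let thetaf : R -> R := quantile id E.

Let thetaf_measurable : measurable_fun (I01 : set R) thetaf.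
Proof. by apply: measurable_funTS; apply: measurable_quantile. Qed.

Let thetaf_I01 t : I01 t -> I01 (thetaf t).
Proof.
move=> /I01P/andP[t0 t1]; apply/I01P; rewrite quantile_ge0//=.
exact: le_trans (quantile_le _ _ _) t1.
Qed.

Let thetaf_le : {ae leb, forall t, I01 t -> thetaf t <= t}.
Proof. by apply: aeW => t _; exact: quantile_le. Qed.

Definition slab_quantile : Theta R :=
  MkTheta thetaf_measurable thetaf_I01 thetaf_le.

Local Notation dth := (delta slab_quantile : probability (R * R)%type R).

Let deltaE (A : set (R * R)) :
  dth A = leb ([set t | A (t, thetaf t)] `&` I01).
Proof. by []. Qed.

Let slabP i t : (i < m)%N -> I01 t ->
  slab i (t, thetaf t) <-> a i < t <= a i.+1.
Proof.
move=> im It; have /I01P/andP[t0 t1] := It.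
have tt : triangle (t, thetaf t).
  by split; [split => //; exact: thetaf_I01|exact: quantile_le].
split.
  by move=> [[_ /= -> nt]]; rewrite andbT ltNge; apply/negP => h; apply: nt.
by move=> /andP[h1 h2]; split => // -[_ /=]; rewrite leNgt h1.
Qed.

(** [sandwich_cvg] is applied to the constant sequence [gamma]; uniqueness of the limit turns the
    sandwich into an equality. *)
Lemma delta_slab_quantile i (psi : R -> R) : (i < m)%N ->
  {within I01, continuous psi} ->
  \int[dth]_(p in slab i) psi p.2 = \int[gamma]_(p in slab i) psi p.2.
Proof.
move=> im cpsi.
have gd := Gamma_delta slab_quantile.
have mb x : measurable (slab i `&` [set p : R * R | p.2 < x]).
  by apply: measurableI => //; exact: measurable_below.
have bE x : (fine (dth (slab i `&` [set p : R * R | p.2 < x])))%:E =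
    dth (slab i `&` [set p : R * R | p.2 < x]).
  by rewrite fineK// fin_num_measure.
have mg x : measurable
    ([set t | (slab i `&` [set p : R * R | p.2 < x]) (t, thetaf t)] `&` I01).
  apply: measurableI; last exact: measurable_I01.
  have mgr : measurable_fun setT (fun t : R => (t, thetaf t)).
    by apply: measurable_fun_pair => //; exact: measurable_quantile.
  by rewrite -[X in measurable X]setTI; exact: mgr.
have c1 : \int[gamma]_(p in slab i) psi p.2 @[n --> \oo] -->
    \int[dth]_(p in slab i) psi p.2.
  apply: (@sandwich_cvg _ (slab i) _ _ \oo _ (fun=> gamma) dth (a i.+1 - a i) (c i)) => //.
  - by move=> p [/tri_snd].
  - by move=> n; apply: gamma_slab => //; [exact: a_le|exact: a1].
  - by apply: gamma_slab => //; [exact: a_le|exact: a1].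
  - by move=> q q0; exact: cvg_cst.
  - move=> q q0; rewrite -lee_fin bE.
    have -> : (c i q)%:E = leb `]a i, (a i + c i q)].
      rewrite lebesgue_measure_itv/= lte_fin ltrDl lt_neqAle c0 andbT eq_sym.
      by case: eqVneq => [->//|_]; rewrite -EFinB addrAC subrr add0r.
    rewrite deltaE; apply: le_measure; rewrite ?inE//; do ?[exact: mg].
    move=> t [[st /= tq] It] /=; rewrite in_itv/=.
    have /(slabP im It)/andP[ait tai] := st; rewrite ait/=.
    (* First case: the cap is responsible, t < q. The part of the slab up to time t satisfies s <=
       tau <= t < q and has mass t - a i, so c i q is at least t - a i: here the support of [gamma]
       in the triangle is used. *)
    have [tq'|[r [r0 Er rq]]] := iffLR (quantile_lt _ _ _ _) tq.
      rewrite -lerBlDl -lee_fin cE.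
      have /I01P/andP[t0 t1] := It.
      rewrite -(gamma_slab gG (a0 i) (ltW ait) t1); apply: le_measure; rewrite ?inE//.
        by apply: measurableD; exact: measurable_tri.
      move=> p [[tp /= pt] np]; split.
        by split => //; split => //=; exact: le_trans tai.
      by have [_ p21 _] := iffLR (triangleP p) tp; rewrite /= (le_trans p21)// (le_trans pt)// ltW.
    apply/ltW; apply: lt_le_trans (E_slab im ait tai Er) _.
    by rewrite lerD2l c_le// -(ler_rat R) ltW.
  - move=> q r q0 qr; rewrite -lee_fin bE.
    have -> : (c i q)%:E = leb `]a i, (a i + c i q)[.
      rewrite lebesgue_measure_itv/= lte_fin ltrDl lt_neqAle c0 andbT eq_sym.
      by case: eqVneq => [->//|_]; rewrite -EFinB addrAC subrr add0r.
    rewrite deltaE; apply: le_measure; rewrite ?inE//; do ?[exact: mg].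
    move=> t /=; rewrite in_itv/= => /andP[ait tac].
    have tai : t <= a i.+1 by apply/ltW; apply: lt_le_trans tac (c_slab q im).
    have It : I01 t.
      by apply/I01P; rewrite (le_trans (a0 i) (ltW ait)) (le_trans tai (a1 im)).
    split => //; split; first by apply/(slabP im It); rewrite ait tai.
    apply/quantile_lt; right; exists q; split => //; last by rewrite ltr_rat.
    by exists i => //=; rewrite in_itv/= ait.
exact: (cvg_unique _ c1 (cvg_cst _)).
Qed.

Lemma delta_tri_quantile i (psi : R -> R) : (i <= m)%N ->
  {within I01, continuous psi} ->
  \int[dth]_(p in tri (a i)) psi p.2 = \int[gamma]_(p in tri (a i)) psi p.2.
Proof.
move=> + cpsi; have gd := Gamma_delta slab_quantile.
elim: i => [_|i IH im]; first by rewrite /a mul0r !Rintegral_tri0.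
have [m1 m2] := (measurable_tri (a i), measurable_tri (a i.+1)).
have sub : tri (a i) `<=` tri (a i.+1) by apply: tri_sub; exact: a_le.
rewrite (Rintegral_setD m1 m2 sub (integrable_tri dth (a i.+1) cpsi)).
rewrite (Rintegral_setD m1 m2 sub (integrable_tri gamma (a i.+1) cpsi)).
by rewrite IH ?(ltnW im)// delta_slab_quantile.
Qed.

(** At the slab ends the integrals coincide; from the last end before t, each of them moves by at
    most M / m. *)
Lemma delta_quantile_dist (psi : R -> R) (M t : R) :
  {within I01, continuous psi} -> (forall s, I01 s -> `|psi s| <= M) -> I01 t ->
  `|\int[dth]_(p in tri t) psi p.2 - \int[gamma]_(p in tri t) psi p.2| <=
  2 * M / m%:R.
Proof.
move=> cpsi HM It; have /I01P/andP[t0 t1] := It.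
have gd := Gamma_delta slab_quantile.
have M0 : 0 <= M by apply: le_trans (HM _ It).
pose i := Num.truncn (t * m%:R).
have tm0 : 0 <= t * m%:R by rewrite mulr_ge0.
have /andP[i1 i2] := truncn_itv tm0.
have ait : a i <= t by rewrite ler_pdivrMr.
have tai : t - a i <= m%:R^-1.
  by rewrite -(aS i) lerB// ler_pdivlMr// ltW.
have im : (i <= m)%N.
  by rewrite -(ler_nat R) (le_trans i1)// ler_piMl.
have h g' : Gamma g' ->
    `|\int[g']_(p in tri t) psi p.2 - \int[g']_(p in tri (a i)) psi p.2| <= M / m%:R.
  move=> g'G; apply: (@le_trans _ _ (M * (t - a i))); last by rewrite ler_wpM2l.
  apply: tri_slab_bdd => //; first exact: integrable_tri.
  by move=> p [/tri_snd Ip _]; exact: HM.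
have := h _ gG; have := h _ gd; rewrite delta_tri_quantile//.
set A := Rintegral _ _ _; set B := Rintegral _ _ _; set C := Rintegral _ _ _.
move: A B C => A B C; rewrite !ler_norml -mulrA => /andP[? ?] /andP[? ?].
by apply/andP; split; lra.
Qed.

End theta_approximation.

Lemma theta_approximation (R : realType) (gamma : probability (R * R)%type R) :
  Gamma gamma -> exists theta : nat -> Theta R,
    slab_cvg \oo (fun n => delta (theta n)) gamma.
Proof.
move=> gG; exists (fun n => slab_quantile gamma n.+1) => t It psi cpsi.
have [M M0 HM] := compact_bdd (@compact_I01 R) cpsi.
apply/cvgrPdist_le => e e0.
have r0 : 0 < e / (2 * M + 1) by rewrite divr_gt0//; lra.
have [N [N0 Ne]] := mesh_lt r0.
exists N => // n /= Nn; rewrite distrC.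
apply: le_trans (delta_quantile_dist gG (ltn0Sn n) cpsi HM It) _.
have nN : n.+1%:R^-1 <= N%:R^-1 :> R.
  by rewrite lef_pV2 ?posrE ?ltr0n// ler_nat; exact: leqW.
apply: (@le_trans _ _ ((2 * M + 1) * (e / (2 * M + 1)))).
  apply: ler_pM => //; [by lra|by lra|].
  by apply: le_trans nN _; exact: ltW.
by rewrite mulrCA divff ?mulr1// gt_eqF//; lra.
Qed.

(** * Densities of limits *)

Lemma ultra_bounded_cvg (R : realType) (U : set_system nat) (u : nat -> R)
    (a b : R) :
  UltraFilter U -> (forall n, a <= u n <= b) -> exists l : R, u n @[n --> U] --> l.
Proof.
move=> FU uab.
have PU : ProperFilter U := @ultra_proper _ U FU.
have uU : U (u @^-1` `[a, b]%classic).
  rewrite (_ : _ @^-1` _ = setT); first exact: filterT.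
  by apply/seteqP; split => // n _ /=; rewrite in_itv/=; exact: uab.
have [l [_ cl]] := @segment_compact R a b (u @ U) _ uU.
exists l => V lV; have [//|UV] := in_ultra_setVsetC (u @^-1` V) FU.
have /(cl _ V)/(_ lV)[x [/= nVx Vx]] : (u @ U) (~` V) by [].
by [].
Qed.

Section dominated_density.
Context d (T : measurableType d) (R : realType) (P : probability T R).
Variable mu : set T -> R.
Hypothesis mu_ge0 : forall A, 0 <= mu A.
Hypothesis muU : forall A B, measurable A -> measurable B ->
  A `&` B = set0 -> mu (A `|` B) = mu A + mu B.
Hypothesis mu_le : forall A, measurable A -> mu A <= fine (P A).

Definition dominated_content (A : set T) : \bar R := (mu A)%:E.

Let mu0 : mu set0 = 0.
Proof.
by apply/eqP; rewrite eq_le mu_ge0 andbT; have := mu_le measurable0; rewrite measure0.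
Qed.

Let content0 : dominated_content set0 = 0%E.
Proof. by rewrite /dominated_content mu0. Qed.

Let content_ge0 A : (0 <= dominated_content A)%E.
Proof. by rewrite lee_fin. Qed.

Let mu_bigU (F : nat -> set T) : (forall i, measurable (F i)) ->
  trivIset setT F -> forall n,
  mu (\big[setU/set0]_(i < n) F i) = \sum_(i < n) mu (F i).
Proof.
move=> mF tF; elim=> [|n IH]; first by rewrite !big_ord0.
rewrite !big_ord_recr/= muU ?IH//; first exact: bigsetU_measurable.
rewrite -bigcup_mkord; apply/seteqP; split => // x [[i /= ilt Fi] Fn].
by move: ilt; have -> : i = n by [apply: (tF _ _ I I); exists x]; rewrite ltnn.
Qed.

(* An additive set function dominated by a finite measure is countably
   additive: its tails are dominated by the tails of that measure. *)
Let content_sigma_additive : semi_sigma_additive dominated_content.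
Proof.
move=> F mF tF mUF.
have := @measure_semi_sigma_additive _ _ _ P F mF tF mUF.
have Pfin (A : set T) : measurable A -> P A \is a fin_num.
  by move=> mA; exact: fin_num_measure.
have sumE n : (\sum_(0 <= i < n) P (F i) = (\sum_(i < n) fine (P (F i)))%:E)%E.
  by rewrite big_mkord -sumEFin; apply: eq_bigr => i _; rewrite fineK ?Pfin.
under eq_fun do rewrite sumE.
move=> cP0; have /fine_cvgP[_ cP] : (\sum_(i < n) fine (P (F i)))%:E @[n --> \oo] -->
    (fine (P (\bigcup_n F n)))%:E by rewrite fineK ?Pfin.
have -> : (fun n => \sum_(0 <= i < n) dominated_content (F i))%E =
    EFin \o (fun n => \sum_(i < n) mu (F i)).
  by apply/funext => n; rewrite big_mkord /= -sumEFin.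
apply: cvg_EFin; first by apply: nearW.
apply/cvgrPdist_le => e e0.
have := cP; move=> /cvgrPdist_le/(_ _ e0); apply: filterS => n.
rewrite /comp -mu_bigU// => Hn.
pose V := \big[setU/set0]_(i < n) F i.
have mV : measurable V by exact: bigsetU_measurable.
have VU : V `<=` \bigcup_i F i.
  by rewrite /V -bigcup_mkord => x [i _ Fi]; exists i.
have mUV : measurable (\bigcup_i F i `\` V) by exact: measurableD.
have E1 : mu (\bigcup_i F i) = mu V + mu (\bigcup_i F i `\` V).
  by rewrite -{1}(setDUK VU) muU// setDIK.
have PV : fine (P V) = \sum_(i < n) fine (P (F i)).
  by rewrite /V measure_bigsetU// sum_fine// => i _; exact: Pfin.
have E2 : fine (P (\bigcup_i F i)) = fine (P V) + fine (P (\bigcup_i F i `\` V)).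
  rewrite -fineD ?Pfin// -measureU//; last by rewrite setDIK.
  by rewrite setDUK.
rewrite /= E1 -/V addrAC subrr add0r ger0_norm//.
apply: le_trans (mu_le mUV) _; move: Hn.
rewrite /= -PV E2 addrAC subrr add0r; apply: le_trans; exact: ler_norm.
Qed.

HB.instance Definition _ := isMeasure.Build _ _ _ dominated_content
  content0 content_ge0 content_sigma_additive.

Let content_fin : fin_num_fun dominated_content.
Proof. by []. Qed.

HB.instance Definition _ := @Measure_isFinite.Build _ _ _ dominated_content
  content_fin.

Lemma dominated_density : exists G : T -> R, [/\ measurable_fun setT G,
  forall x, 0 <= G x, P.-integrable setT (EFin \o G) &
  forall A, measurable A -> mu A = \int[P]_(x in A) G x].
Proof.
have dom : dominated_content `<< P.
  apply/null_content_dominatesP => A mA PA0; rewrite /dominated_content.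
  congr EFin; apply/eqP; rewrite eq_le mu_ge0 andbT.
  by have := mu_le mA; rewrite PA0.
have [g [g0 gfin gint gE]] := radon_nikodym_sigma_finite dom.
have gEF : EFin \o (fine \o g) = g by apply/funext => x /=; rewrite fineK.
exists (fine \o g); split.
- by apply/measurable_EFinP; rewrite gEF; exact: measurable_int gint.
- by move=> x; exact: fine_ge0.
- by rewrite gEF.
- move=> A mA; have := gE A mA; rewrite /dominated_content /Rintegral => h.
  by rewrite (_ : (fun x => ((fine \o g) x)%:E) = g) -?h//.
Qed.

End dominated_density.

Lemma measurable_lt_set d (T : measurableType d) (R : realType) (f g : T -> R) :
  measurable_fun setT f -> measurable_fun setT g ->
  measurable [set x | f x < g x].
Proof.
move=> mf mg; have := measurable_fun_ltr mf mg measurableT (Y := [set true]) I.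
by rewrite setTI.
Qed.

Section density_comparison.
Context d (T : measurableType d) (R : realType) (P : probability T R).

(** The hypothesis is tested on the bad set itself, where G1 - G2 is positive and yet has integral
    at most 0. *)
Lemma ae_le_density (G1 G2 : T -> R) :
  measurable_fun setT G1 -> measurable_fun setT G2 ->
  P.-integrable setT (EFin \o G1) -> P.-integrable setT (EFin \o G2) ->
  forall D, measurable D ->
  (forall A, measurable A -> A `<=` D ->
    \int[P]_(x in A) G1 x <= \int[P]_(x in A) G2 x) ->
  P (D `&` [set x | G2 x < G1 x]) = 0%E.
Proof.
move=> m1 m2 i1 i2 D mD H; set N := D `&` _.
have mN : measurable N.
  by apply: measurableI => //; exact: measurable_lt_set.
have iN1 : P.-integrable N (EFin \o G1) by apply: integrableS i1.
have iN2 : P.-integrable N (EFin \o G2) by apply: integrableS i2.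
pose h x := G1 x - G2 x.
have ih : P.-integrable N (EFin \o h) by have := integrableB mN iN1 iN2.
have mh : measurable_fun N (EFin \o h) := measurable_int _ ih.
have h0 : \int[P]_(x in N) h x <= 0.
  by rewrite RintegralB// subr_le0; apply: H => // x [].
have : (\int[P]_(x in N) `|(EFin \o h) x| = 0)%E.
  rewrite (eq_integral (EFin \o h)); last first.
    by move=> x /set_mem[_ /= lt]; rewrite ger0_norm// subr_ge0 ltW.
  apply/eqP; rewrite eq_le; apply/andP; split.
    by rewrite -(fineK (integrable_fin_num mN ih)) lee_fin.
  by apply: integral_ge0 => x [_ /= lt]; rewrite lee_fin subr_ge0 ltW.
move=> /(ae_eq_integral_abs P mN mh) [Z [mZ Z0 NZ]].
apply: (subset_measure0 mN mZ _ Z0) => x Nx; apply: NZ => /= /(_ Nx) [].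
by case: Nx => _ /= lt; move/eqP; rewrite /h subr_eq0 gt_eqF.
Qed.

End density_comparison.

Section densities.
Context (R : realType) (P : probability R R) (mu : rat -> set R -> R).
Hypothesis mu_ge0 : forall q A, 0 <= mu q A.
Hypothesis muU : forall q A B, measurable A -> measurable B ->
  A `&` B = set0 -> mu q (A `|` B) = mu q A + mu q B.
Hypothesis mu_le : forall q A, measurable A -> mu q A <= fine (P A).
Hypothesis mu_mono : forall q r A, measurable A -> q <= r -> mu q A <= mu r A.
Hypothesis mu_full : forall q A, measurable A ->
  A `<=` [set x : R | x <= ratr q] -> mu q A = fine (P A).

(** Each requirement fails on a null set only, and rational levels leave countably many of them. On
    their union every density is reset to 1, a value compatible with all the pointwise
    requirements. *)
Lemma monotone_densities : exists G : rat -> R -> R,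
  [/\ forall q, measurable_fun setT (G q),
      forall q x, 0 <= G q x <= 1,
      forall q r x, q <= r -> G q x <= G r x,
      forall q x, x <= ratr q -> G q x = 1 &
      forall q A, measurable A -> mu q A = \int[P]_(x in A) G q x].
Proof.
have /choice[G0 HG0] := fun q => dominated_density (mu_ge0 q) (muU q) (mu_le q).
have mG q : measurable_fun setT (G0 q) by case: (HG0 q).
have G0_ge0 q x : 0 <= G0 q x by case: (HG0 q).
have iG q : P.-integrable setT (EFin \o G0 q) by case: (HG0 q).
have G0E q A : measurable A -> mu q A = \int[P]_(x in A) G0 q x.
  by case: (HG0 q) => _ _ _; exact.
have i1 : P.-integrable setT (EFin \o (fun=> 1 : R)).
  apply: (integrable_bdd (M := 1)) => //.
    by rewrite (le_lt_trans (probability_le1 _ _))// ltry.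
  by move=> x _; rewrite normr1.
have I1 A : measurable A -> \int[P]_(x in A) (1 : R) = fine (P A).
  by move=> mA; rewrite Rintegral_cst// mul1r.
have mcst : measurable_fun (setT : set R) (fun=> 1 : R) by exact: measurable_cst.
pose N1 q := [set x | 1 < G0 q x].
pose N2 q r := if q <= r then [set x | G0 r x < G0 q x] else set0.
pose N3 q := [set x : R | x <= ratr q] `&` [set x | G0 q x < 1].
have mle q : measurable [set x : R | x <= ratr q].
  have -> : [set x : R | x <= ratr q] = `]-oo, ratr q]%classic.
    by apply/seteqP; split => x /=; rewrite in_itv.
  exact: measurable_itv.
have N1_0 q : measurable (N1 q) /\ P (N1 q) = 0%E.
  split; first exact: measurable_lt_set.
  rewrite -[N1 q]setTI; apply: (ae_le_density (mG q) mcst (iG q) i1 measurableT) => A mA _.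
  by rewrite -G0E// I1// mu_le.
have N2_0 q r : measurable (N2 q r) /\ P (N2 q r) = 0%E.
  rewrite /N2; case: ifPn => qr; last by split => //; exact: measure0.
  split; first exact: measurable_lt_set.
  rewrite -[X in P X]setTI.
  apply: (ae_le_density (mG q) (mG r) (iG q) (iG r) measurableT) => A mA _.
  by rewrite -!G0E// mu_mono.
have N3_0 q : measurable (N3 q) /\ P (N3 q) = 0%E.
  split; first by apply: measurableI => //; exact: measurable_lt_set.
  apply: (ae_le_density mcst (mG q) i1 (iG q) (mle q)) => A mA Aq.
  by rewrite -G0E// I1// mu_full.
pose N0 (qr : rat * rat) := N1 qr.1 `|` (N2 qr.1 qr.2 `|` N3 qr.1).
have N0_0 qr : measurable (N0 qr) /\ P (N0 qr) = 0%E.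
  have [[m1 z1] [[m2 z2] [m3 z3]]] := (N1_0 qr.1, (N2_0 qr.1 qr.2, N3_0 qr.1)).
  have m23 := measurableU _ _ m2 m3; split; first exact: measurableU.
  by rewrite measureU0// measureU0.
pose N := \bigcup_n (if @unpickle (rat * rat)%type n is Some qr then N0 qr else set0).
have mN : measurable N.
  apply: bigcup_measurable => n _; case: unpickle => // qr.
  by case: (N0_0 qr).
have PN : P N = 0%E.
  have /negligibleP : P.-negligible N.
    apply: negligible_bigcup => n; case: unpickle => [qr|]; last exact: negligible_set0.
    by case: (N0_0 qr) => m z; apply/negligibleP.
  exact.
have sub q r : N0 (q, r) `<=` N.
  move=> x Nx; exists (pickle (q, r)); first exact: I.
  rewrite pickleK; exact: Nx.
pose G q x := if x \in N then 1 else G0 q x.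
have GE q : G q = fun x => G0 q x * (1 - \1_N x) + \1_N x.
  apply/funext => x; rewrite /G indicE; case: (x \in N).
    by rewrite subrr mulr0 add0r.
  by rewrite subr0 mulr1 addr0.
have mGq q : measurable_fun setT (G q).
  rewrite GE; apply: measurable_funD; last exact: measurable_indic.
  apply: measurable_funM => //; apply: measurable_funB => //.
exists G; split => //.
- move=> q x; rewrite /G; case: ifPn => [_|/negP xN]; first by rewrite ler01 lexx.
  rewrite G0_ge0/= leNgt; apply/negP => h; apply: xN; apply/mem_set.
  by apply: (sub q q); left.
- move=> q r x qr; rewrite /G; case: ifPn => // /negP xN.
  rewrite leNgt; apply/negP => h; apply: xN; apply/mem_set.
  by apply: (sub q r); right; left; rewrite /N2 /= qr.
- move=> q x xq; rewrite /G; case: ifPn => // /negP xN.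
  apply/eqP; rewrite eq_le !leNgt; apply/andP; split; apply/negP => h;
    apply: xN; apply/mem_set; apply: (sub q q); first by left.
  by right; right.
- move=> q A mA; rewrite G0E// /Rintegral; congr fine.
  apply: ae_eq_integral => //.
  + by apply/measurable_EFinP; apply: measurable_funTS.
  + by apply/measurable_EFinP; apply: measurable_funTS.
  + exists N; split => // x /= /not_implyP[_ h]; apply: contrapT => nN; apply: h.
    by rewrite /G memNset.
Qed.

End densities.

Lemma le_cvg_filter (R : realType) (U : set_system nat) (FU : ProperFilter U)
    (u v : nat -> R) (a b : R) :
  u n @[n --> U] --> a -> v n @[n --> U] --> b -> (forall n, u n <= v n) ->
  a <= b.
Proof.
move=> ua vb uv; rewrite leNgt; apply/negP => ba.
have e0 : 0 < (a - b) / 2 by rewrite divr_gt0// subr_gt0.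
have /cvgrPdist_lt/(_ _ e0) h1 := ua; have /cvgrPdist_lt/(_ _ e0) h2 := vb.
have [n [n1 n2]] := @filter_ex _ U _ _ (filterI h1 h2).
have := uv n; move: n1 n2; rewrite !ltr_norml => /andP[? ?] /andP[? ?] ?.
by lra.
Qed.

Definition fst_mfun (R : realType) : {mfun (R * R)%type >-> R} :=
  HB.pack (@fst R R) (isMeasurableFun.Build _ _ _ _ _ measurable_fst).

Section uniform_marginal.
Context (R : realType) (gamma : probability (R * R)%type R).
Hypothesis gG : Gamma gamma.
Local Notation leb := (@lebesgue_measure R).

(** For [gamma] in [Gamma] this is the uniform law on [0,1] as a probability on R. It later serves
    both as the law of t and as that of the quantile variable u. *)
Definition marginal : probability R R := distribution gamma (fst_mfun R).

Lemma marginalE (A : set R) : measurable A -> marginal A = leb (A `&` I01).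
Proof. by move=> mA; case: gG => _ /(_ A mA). Qed.

Lemma integral_marginal (F : R -> \bar R) : measurable_fun setT F ->
  (\int[marginal]_x F x = \int[leb]_(x in I01) F x)%E.
Proof.
have ge0 (f : R -> \bar R) : measurable_fun setT f -> (forall x, 0 <= f x)%E ->
    (\int[marginal]_x f x = \int[leb]_(x in I01) f x)%E.
  move=> mf f0.
  have mf' : measurable_fun (setT : set (measurableTypeR R)) f.
    by move=> _ A mA; exact: (mf measurableT A mA).
  have mX : measurable_fun setT (fst : R * R -> measurableTypeR R).
    by move=> mT A mA; exact: (measurable_fst mT A mA).
  pose X : {mfun (R * R)%type >-> measurableTypeR R} :=
    HB.pack (fst : R * R -> measurableTypeR R) (isMeasurableFun.Build _ _ _ _ _ mX).
  rewrite ge0_integral_distribution//.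
  transitivity (\int[pushforward gamma X]_x f x)%E.
    by rewrite ge0_integral_pushforward//.
  rewrite (eq_measure_integral (uniform_prob (@ltr01 R))) => [|A mA _].
    by rewrite integral_uniform// subr0 invr1 mul1e.
  transitivity (leb (A `&` I01)); first exact: marginalE.
  rewrite /= /uniform_prob integral_uniform_pdf.
  rewrite (eq_integral (cst 1%E)) => [|t].
    by rewrite integral_cst ?mul1e//; exact: measurableI.
  by rewrite inE/= in_itv/= => -[_ It]; rewrite /uniform_pdf It subr0 invr1.
move=> mF; rewrite integralE [RHS]integralE !ge0//.
  exact: measurable_funeneg.
exact: measurable_funepos.
Qed.

Lemma marginal_lt (c : R) : 0 <= c <= 1 -> marginal [set u | u < c] = c%:E.
Proof.
move=> /andP[c0 c1].
have m : measurable [set u : R | u < c].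
  have -> : [set u : R | u < c] = `]-oo, c[%classic.
    by apply/seteqP; split => x /=; rewrite in_itv.
  exact: measurable_itv.
rewrite marginalE// (_ : _ `&` _ = `[0, c[%classic); last first.
  apply/seteqP; split => x /=; rewrite /I01/= !in_itv/=.
    by move=> [-> /andP[-> _]].
  by move=> /andP[-> xc]; split => //; rewrite (le_trans (ltW xc)).
rewrite lebesgue_measure_itv/= lte_fin lt_neqAle c0 andbT eq_sym.
by case: eqVneq => [->//|_]; rewrite oppr0 adde0.
Qed.

(* The part above 1 is null. *)
Lemma marginal_le (c : R) : 0 <= c <= 1 ->
  marginal [set u | u <= c \/ 1 < u] = c%:E.
Proof.
move=> /andP[c0 c1].
have m : measurable [set u : R | u <= c \/ 1 < u].
  have -> : [set u : R | u <= c \/ 1 < u] = `]-oo, c]%classic `|` `]1, +oo[%classic.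
    by apply/seteqP; split => x /=; rewrite !in_itv/= andbT.
  by apply: measurableU; exact: measurable_itv.
rewrite marginalE// (_ : _ `&` _ = `[0, c]%classic); last first.
  apply/seteqP; split => x /=; rewrite /I01/= !in_itv/=.
    by move=> [[->|x1] /andP[-> x1']] //; move: x1; rewrite ltNge x1'.
  by move=> /andP[-> xc]; split; [left|rewrite (le_trans xc)].
rewrite lebesgue_measure_itv/= lte_fin lt_neqAle c0 andbT eq_sym.
by case: eqVneq => [->//|_]; rewrite oppr0 adde0.
Qed.

End uniform_marginal.

(** * Limits along an ultrafilter *)

Section limit_kernel.
Context (R : realType) (U : set_system nat) (FU : UltraFilter U).
Variable gn : nat -> probability (R * R)%type R.
Hypothesis gnG : forall n, Gamma (gn n).
Local Notation leb := (@lebesgue_measure R).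
(** The index 0 is arbitrary: all [gn n] have the same first marginal. *)
Local Notation unif := (marginal (gn 0%N)).

Let PU : ProperFilter U := @ultra_proper _ U FU.

Let strip (q : rat) (A : set R) : set (R * R) :=
  (triangle `&` fst @^-1` A) `&` [set p | p.2 <= ratr q].

Let mstrip q A : measurable A -> measurable (strip q A).
Proof.
move=> mA; apply: measurableI; last exact: measurable_upto.
by apply: measurableI; [exact: measurable_triangle|exact: measurable_fst_preimage].
Qed.

(* The truncation by 1 only matters for non-measurable [A]. *)
Let u q A n : R := Num.min 1 (fine (gn n (strip q A))).

Let mu q A : R := lim (u q A n @[n --> U]).

Let u_ge0 q A n : 0 <= u q A n.
Proof. by rewrite le_min ler01 fine_ge0. Qed.

Let mu_cvg q A : u q A n @[n --> U] --> mu q A.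
Proof.
have [|l ul] := @ultra_bounded_cvg R U (u q A) 0 1 FU.
  by move=> n; rewrite u_ge0 ge_min lexx.
by rewrite /mu (cvg_lim _ ul)//; exact: Rhausdorff.
Qed.

Let uE q A n : measurable A -> u q A n = fine (gn n (strip q A)).
Proof.
move=> mA; apply/min_idPr; rewrite -lee_fin fineK ?probability_le1//.
  exact: mstrip.
by apply: fin_num_measure; exact: mstrip.
Qed.

Let gnfin n A : measurable A -> gn n A \is a fin_num.
Proof. by move=> mA; exact: fin_num_measure. Qed.

Let mu_ge0 q A : 0 <= mu q A.
Proof.
apply: (@le_cvg_filter R U PU (fun=> 0) (u q A)).
- exact: cvg_cst.
- exact: mu_cvg.
- by move=> n; exact: u_ge0.
Qed.

Let muU q A B : measurable A -> measurable B -> A `&` B = set0 ->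
  mu q (A `|` B) = mu q A + mu q B.
Proof.
move=> mA mB AB0.
have uU n : u q (A `|` B) n = u q A n + u q B n.
  have mAB := measurableU _ _ mA mB.
  rewrite !uE// -fineD ?gnfin//; do ?[exact: mstrip].
  rewrite -measureU//; do ?[exact: mstrip].
    congr (fine (gn n _)); apply/seteqP; split => p.
      by move=> [[tp [Ap|Bp]] pq]; [left|right].
    by move=> [|] [[tp Ap] pq]; split => //; split => //; [left|right].
  apply/seteqP; split => // p [[[_ Ap] _] [[_ Bp] _]].
  have : (A `&` B) p.1 by split.
  by rewrite AB0.
have c1 := @mu_cvg q (A `|` B).
have c2 : u q (A `|` B) n @[n --> U] --> mu q A + mu q B.
  by under eq_fun do rewrite uU; apply: cvgD; exact: mu_cvg.
exact: (cvg_unique _ c1 c2).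
Qed.

Let strip_le q A n : measurable A -> fine (gn n (strip q A)) <= fine (unif A).
Proof.
move=> mA; rewrite (marginalE (gnG 0%N) mA) -(gamma_fst (gnG n) mA).
have mtA : measurable (triangle `&` fst @^-1` A : set (R * R)).
  by apply: measurableI; [exact: measurable_triangle|exact: measurable_fst_preimage].
apply: fine_le; rewrite ?gnfin//; first exact: mstrip.
by apply: le_measure; rewrite ?inE//; [exact: mstrip|move=> p []].
Qed.

Let mu_le q A : measurable A -> mu q A <= fine (unif A).
Proof.
move=> mA; apply: (@le_cvg_filter R U PU (u q A) (fun=> fine (unif A))).
- exact: mu_cvg.
- exact: cvg_cst.
- by move=> n; rewrite uE// strip_le.
Qed.

Let mu_mono q r A : measurable A -> q <= r -> mu q A <= mu r A.
Proof.
move=> mA qr; apply: (@le_cvg_filter R U PU (u q A) (u r A)); do ?[exact: mu_cvg].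
move=> n; rewrite !uE//; apply: fine_le; rewrite ?gnfin//; do ?[exact: mstrip].
apply: le_measure; rewrite ?inE//; do ?[exact: mstrip].
by move=> p [tp /= pq]; split => //=; rewrite (le_trans pq)// ler_rat.
Qed.

(** If tau <= q on A, then s <= q holds automatically on the triangle. This is how the constraint s
    <= tau survives in the limit, as [G q x] = 1 for x <= q. *)
Let mu_full q A : measurable A -> A `<=` [set x : R | x <= ratr q] ->
  mu q A = fine (unif A).
Proof.
move=> mA Aq; have c1 := @mu_cvg q A.
have uc n : u q A n = fine (unif A).
  rewrite uE// (marginalE (gnG 0%N) mA) -(gamma_fst (gnG n) mA).
  congr (fine (gn n _)); apply/seteqP; split => [p []//|p [tp Ap]].
  split => //=; have [_ p21 _] := iffLR (triangleP p) tp.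
  by apply: le_trans p21 _; exact: Aq.
have c2 : u q A n @[n --> U] --> fine (unif A).
  by under eq_fun do rewrite uc; exact: cvg_cst.
exact: (cvg_unique _ c1 c2).
Qed.

Lemma limit_density : exists G : rat -> R -> R,
  [/\ forall q, measurable_fun setT (G q),
      forall q x, 0 <= G q x <= 1,
      forall q r x, q <= r -> G q x <= G r x,
      forall q x, x <= ratr q -> G q x = 1 &
      forall t, I01 t -> forall q,
        fine (gn n (tri t `&` [set p | p.2 <= ratr q])) @[n --> U] -->
        \int[unif]_(x in `[0, t]) G q x].
Proof.
have [G [mG G01 Gmono Gfull GE]] :=
  monotone_densities mu_ge0 muU mu_le mu_mono mu_full.
exists G; split => // t It q; rewrite -GE; last exact: measurable_itv.
have E n : u q `[0, t]%classic n = fine (gn n (tri t `&` [set p | p.2 <= ratr q])).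
  rewrite uE; last exact: measurable_itv.
  congr (fine (gn n _)); apply/seteqP; split => p.
    by move=> [[tp /=]]; rewrite in_itv/= => /andP[_ pt] pq.
  move=> [[tp /= pt] pq]; split => //; split => //=; rewrite in_itv/= pt andbT.
  by have [p0 p21 _] := iffLR (triangleP p) tp; exact: le_trans p21.
by have := @mu_cvg q `[0, t]%classic; under eq_fun do rewrite E.
Qed.

End limit_kernel.

(** * The limit measure and its kernel *)

Section kernel.
Context (R : realType) (P : probability R R) (G : rat -> R -> R).
Local Notation leb := (@lebesgue_measure R).
Hypothesis PE : forall A, measurable A -> P A = leb (A `&` I01).
Hypothesis P_integral : forall F : R -> \bar R, measurable_fun setT F ->
  (\int[P]_x F x = \int[leb]_(x in I01) F x)%E.
Hypothesis P_lt : forall c, 0 <= c <= 1 -> P [set u : R | u < c] = c%:E.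
Hypothesis P_le : forall c, 0 <= c <= 1 -> P [set u : R | u <= c \/ 1 < u] = c%:E.
Hypothesis mG : forall q, measurable_fun setT (G q).
Hypothesis G01 : forall q x, 0 <= G q x <= 1.
Hypothesis G_mono : forall q r x, q <= r -> G q x <= G r x.
Hypothesis G_full : forall q x, x <= ratr q -> G q x = 1.

Let E (q : rat) : set (R * R) := [set z | z.2 < G q z.1].

Let mE q : measurable (E q).
Proof.
apply: (measurable_lt_set (f := snd) (g := G q \o fst)).
  exact: measurable_snd.
exact: measurableT_comp measurable_fst.
Qed.

(** Q (t, u) inverts q -> G q t at u, capped at t. The cap gives [kernel_nu t] full mass on [0, t]
    for every t in [0,1], not merely almost every t. *)
Let Q : R * R -> R := quantile fst E.

Let mQ : measurable_fun setT Q.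
Proof. by apply: measurable_quantile => //; exact: measurable_fst. Qed.

Let mZ : measurable_fun setT (fun z : R * R => (z.1, Q z)).
Proof. by apply: measurable_fun_pair => //; exact: measurable_fst. Qed.

Let mQt t : measurable_fun setT (fun u : R => Q (t, u)).
Proof. by apply: (measurableT_comp mQ); exact: measurable_fun_pair. Qed.

Let Z : {mfun (R * R)%type >-> (R * R)%type} :=
  HB.pack (fun z : R * R => (z.1, Q z)) (isMeasurableFun.Build _ _ _ _ _ mZ).

Let Qt t : {mfun R >-> R} :=
  HB.pack (fun u : R => Q (t, u)) (isMeasurableFun.Build _ _ _ _ _ (mQt t)).

Let PP : probability (R * R)%type R := (P \x P)%E.

Definition kernel_gamma : probability (R * R)%type R := distribution PP Z.

Definition kernel_nu (t : R) : probability R R := distribution P (Qt t).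

Let Q_le z : Q z <= z.1. Proof. exact: quantile_le. Qed.

Let Q_ge0 z : 0 <= z.1 -> 0 <= Q z. Proof. exact: quantile_ge0. Qed.

Let P_I01 : P I01 = 1%E.
Proof.
rewrite PE; last exact: measurable_I01.
by rewrite setIid lebesgue_measure_itv/= lte_fin ltr01 oppr0 adde0.
Qed.

Let PPX A : measurable A -> PP (A `*` setT) = P A.
Proof.
move=> mA; transitivity (P A * P setT)%E; first exact: product_measure1E.
by rewrite probability_setT mule1.
Qed.

Lemma Gamma_kernel : Gamma kernel_gamma.
Proof.
split; last first.
  move=> A mA.
  transitivity (PP (A `*` setT)); last by rewrite PPX// PE.
  by congr (product_measure1 _ _ _); apply/seteqP; split => z //= [].
apply/eqP; rewrite eq_le probability_le1/=; last exact: measurable_triangle.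
have mI := @measurable_I01 R.
have <- : PP (I01 `*` setT) = 1%E by rewrite PPX// P_I01.
 apply: le_measure; rewrite ?inE.
- by apply: measurableX.
- by rewrite -[X in measurable X]setTI; apply: mZ => //; exact: measurable_triangle.
- move=> z [/I01P/andP[z0 z1] _]; apply/triangleP; split => //=.
  exact: Q_ge0.
Qed.

(* [C x] is the section at [x] of a region that differs from the subgraph
   of [G q] by a null set. *)
Let PP_region t q (C : R -> set R) :
  measurable [set z : R * R | `[0, t]%classic z.1 /\ C z.1 z.2] ->
  (forall x, P (C x) = (G q x)%:E) ->
  PP [set z : R * R | `[0, t]%classic z.1 /\ C z.1 z.2] =
    (\int[P]_(x in `[0%R, t]) (G q x)%:E)%E.
Proof.
move=> mC PC; rewrite /PP/= /product_measure1 [RHS]integral_mkcond.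
apply: eq_integral => x _; rewrite patchE /=; case: ifPn => xt.
  rewrite -PC; congr (P _); apply/seteqP; split => y.
    by rewrite /xsection/= inE => -[].
  by move=> Cy; rewrite /xsection/= inE; split => //; exact: set_mem.
rewrite (_ : xsection _ _ = set0) ?measure0//.
apply/seteqP; split => y //; rewrite /xsection/= inE => -[xt' _].
by move/negP : xt; apply; exact: mem_set.
Qed.

Let iG t q : P.-integrable `[0, t] (EFin \o G q).
Proof.
apply: (integrable_bdd (M := 1)) => //.
- by rewrite (le_lt_trans (probability_le1 _ _))// ltry.
- exact: measurable_funTS.
- by move=> x _; have /andP[g0 g1] := G01 q x; rewrite ger0_norm.
Qed.

Let IGE t q : (\int[P]_(x in `[0, t]) G q x)%:E =
   (\int[P]_(x in `[0%R, t]) (G q x)%:E)%E.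
Proof. by rewrite fineK//; exact: integrable_fin_num (iG t q). Qed.

Let mitv t : measurable [set z : R * R | `[0, t]%classic z.1].
Proof. by apply: measurable_fst_preimage. Qed.

Let kernel_finE A : measurable A -> (fine (kernel_gamma A))%:E = PP (Z @^-1` A).
Proof. by move=> mA; rewrite fineK// fin_num_measure. Qed.

Let mtb t x : measurable (tri t `&` [set p : R * R | p.2 < x]).
Proof. by apply: measurableI; [exact: measurable_tri|exact: measurable_below]. Qed.

Let mZtb t x : measurable (Z @^-1` (tri t `&` [set p : R * R | p.2 < x])).
Proof. by rewrite -[X in measurable X]setTI; apply: mZ. Qed.

(** With [kernel_below_ge], this is the interlacing required by [sandwich_cvg]. *)
Lemma kernel_below_le t q : I01 t ->
  fine (kernel_gamma (tri t `&` [set p | p.2 < ratr q])) <=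
  \int[P]_(x in `[0, t]) G q x.
Proof.
move=> It; rewrite -lee_fin kernel_finE// IGE.
have mC : measurable [set z : R * R | `[0, t]%classic z.1 /\
    [set u | u <= G q z.1 \/ 1 < u] z.2].
  have -> : [set z : R * R | `[0, t]%classic z.1 /\ [set u | u <= G q z.1 \/ 1 < u] z.2] =
     [set z : R * R | `[0, t]%classic z.1] `&`
     (~` [set z : R * R | G q z.1 < z.2] `|` [set z : R * R | 1 < z.2]).
    apply/seteqP; split => z /= [zt H]; split => //.
      by case: H => h; [left; apply/negP; rewrite -leNgt|right].
    by case: H => h; [left; rewrite leNgt; apply/negP|right].
  apply: measurableI => //; apply: measurableU.
    apply: measurableC; apply: (measurable_lt_set (f := G q \o fst) (g := snd)).
      exact: measurableT_comp measurable_fst.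
    exact: measurable_snd.
  exact: (measurable_lt_set (f := cst 1) (g := snd)).
rewrite -(PP_region (C := fun x => [set u | u <= G q x \/ 1 < u]))//; last first.
  by move=> x; rewrite P_le.
apply: le_measure; rewrite ?inE// => -[x u] [[tz /= xt] Qr].
have [p0 p21 p1] := iffLR (triangleP _) tz.
split; first by rewrite /= in_itv/= xt (le_trans p0).
have [|[r [r0 Er rq]]] := iffLR (quantile_lt _ _ _ _) Qr.
  (* The cap is responsible: x < q, so [G q x] = 1 and every u <= 1 qualifies. Points with u > 1 are
     the reason for the extra null part of the region. *)
  move=> /= xr; rewrite G_full; last exact: ltW.
  by have [u1|u1] := leP u 1; [left|right].
left; apply/ltW; apply: lt_le_trans Er _.
by apply: G_mono; rewrite -(ler_rat R) ltW.
Qed.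

Lemma kernel_below_ge t q r : I01 t -> 0 <= q -> q < r ->
  \int[P]_(x in `[0, t]) G q x <=
  fine (kernel_gamma (tri t `&` [set p | p.2 < ratr r])).
Proof.
move=> /I01P/andP[t0 t1] q0 qr; rewrite -lee_fin kernel_finE// IGE.
have mC : measurable [set z : R * R | `[0, t]%classic z.1 /\
    [set u | u < G q z.1] z.2].
  exact: (measurableI _ _ (mitv t) (mE q)).
rewrite -(PP_region (C := fun x => [set u | u < G q x]))//; last first.
  by move=> x; rewrite P_lt.
apply: le_measure; rewrite ?inE// => -[x u] [/=]; rewrite in_itv/= => /andP[x0 xt] ux.
split.
  split => //=; apply/triangleP; split => /=; [exact: Q_ge0|exact: Q_le|].
  exact: le_trans t1.
by apply/quantile_lt; right; exists q; split => //; rewrite ltr_rat.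
Qed.

Let integral_nu (phi : R -> R) t : measurable_fun setT phi ->
  (exists M, forall s, `|phi s| <= M) ->
  (\int[kernel_nu t]_s (phi s)%:E = \int[P]_u (phi (Q (t, u)))%:E)%E.
Proof.
move=> mphi [M HM]; rewrite integral_distribution//; first exact/measurable_EFinP.
have mQt' : measurable_fun setT (phi \o Qt t) by exact: measurableT_comp.
apply: (integrable_bdd (f := phi \o Qt t) (M := M)) => //.
  by rewrite (le_lt_trans (probability_le1 _ _))// ltry.
by move=> u _; exact: HM.
Qed.

Let restrict_bdd d (T : measurableType d) (D : set T) (phi : T -> R) (M : R) :
  measurable D -> measurable_fun D phi -> 0 <= M ->
  (forall s, D s -> `|phi s| <= M) ->
  measurable_fun setT (phi \_ D) /\ forall s, `|(phi \_ D) s| <= M.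
Proof.
move=> mD mphi M0 HM; split; first exact/(measurable_restrictT _ mD).
move=> s; rewrite patchE; case: ifPn => [/set_mem/HM//|_].
by rewrite normr0.
Qed.

Let integrable_PP (phi : R * R -> R) M : measurable_fun setT phi ->
  (forall s, `|phi s| <= M) -> PP.-integrable setT (EFin \o phi).
Proof.
move=> mphi HM; apply: (integrable_bdd (M := M)) => //.
by rewrite (le_lt_trans (probability_le1 _ _))// ltry.
Qed.

(** Integrals against [kernel_nu t] are integrals over u of functions of Q (t, u), so measurability
    in t and the disintegration formula are both Fubini for P x P, applied to the test function
    extended by 0. *)
Lemma disintegration_kernel : disintegration kernel_gamma kernel_nu.
Proof.
have mI := @measurable_I01 R.
have mS := @measurable_square R.
split.
- move=> t /I01P/andP[t0 t1].
  rewrite -[RHS](@probability_setT _ _ _ P); congr (P _).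
  apply/seteqP; split => u // _ /=; rewrite in_itv/=.
  by apply/andP; split; [exact: Q_ge0|exact: Q_le].
- move=> phi cphi; have [M M0 HM] := compact_bdd (@compact_I01 R) cphi.
  have [mphi' HM'] := restrict_bdd mI (measurable_within1 cphi) M0 HM.
  have mphiQ : measurable_fun setT ((phi \_ I01) \o Q) by exact: measurableT_comp.
  have iQ := integrable_PP mphiQ (fun z => HM' (Q z)).
  have mF := measurable_fubini_F iQ.
  apply: measurable_funTS.
  rewrite [X in measurable_fun _ X](_ : _ = fine \o fubini_F P (EFin \o ((phi \_ I01) \o Q))).
    by apply: measurableT_comp => //.
  apply/funext => t; rewrite /Rintegral integral_mkcond.
  congr fine; rewrite /fubini_F -(integral_nu t mphi'); last by exists M.
  by apply: eq_integral => s _; rewrite restrict_EFin.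
- move=> phi cphi.
  have [M M0 HM] := compact_bdd (compact_setX (@compact_I01 R) (@compact_I01 R)) cphi.
  have [mphi' HM'] := restrict_bdd mS (measurable_within2 cphi) M0 HM.
  set psi := phi \_ (I01 `*` I01) in mphi' HM'.
  have mpsiZ : measurable_fun setT (psi \o Z) by exact: measurableT_comp.
  have iZ := integrable_PP mpsiZ (fun z => HM' (Z z)).
  rewrite {1}/Rintegral integral_mkcond.
  rewrite (eq_integral (EFin \o psi)); last first.
    by move=> z _; rewrite restrict_EFin.
  rewrite integral_distribution//; last by apply/measurable_EFinP.
  rewrite -(integral12_prod_meas1 iZ) P_integral; last exact: measurable_fubini_F iZ.
  congr fine; apply: eq_integral => t /set_mem It.
  have mt : measurable_fun setT (fun s => psi (t, s)).
    by apply: (measurableT_comp mphi'); exact: measurable_fun_pair.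
  have -> : fubini_F P (EFin \o (psi \o Z)) t = (\int[kernel_nu t]_s (psi (t, s))%:E)%E.
    by rewrite integral_nu//; exists M => s; exact: HM'.
  rewrite /Rintegral fineK; last first.
    apply: integrable_fin_num => //.
    apply: (integrable_bdd (f := fun s => phi (t, s)) (M := M)) => //.
    - by rewrite (le_lt_trans (probability_le1 _ _))// ltry.
    - have mts : measurable_fun I01 (fun s => psi (t, s)) by exact: measurable_funTS.
      apply: eq_measurable_fun mts => s /set_mem Is.
      by rewrite /psi patchE mem_set.
    - by move=> s Is; apply: HM.
  rewrite [RHS]integral_mkcond; apply: eq_integral => s _.
  rewrite /psi !patchE/=; have [Is|nIs] := boolP (s \in I01).
    by rewrite mem_set//; split => //; exact: set_mem.
  rewrite memNset// => -[_ /= Is].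
  by move/negP : nIs; apply; exact: mem_set.
Qed.

End kernel.

(** * Limit points, disintegrations and the minimum *)

Lemma limit_measure (R : realType) (U : set_system nat)
    (gn : nat -> probability (R * R)%type R) :
  UltraFilter U -> (forall n, Gamma (gn n)) ->
  exists gamma : probability (R * R)%type R, [/\ Gamma gamma,
    exists nu, disintegration gamma nu & slab_cvg U gn gamma].
Proof.
move=> FU gnG; have PU : ProperFilter U := @ultra_proper _ U FU.
have [G [mG G01 Gmono Gfull Gcvg]] := limit_density FU gnG.
have g0 := gnG 0%N.
have Plt c : 0 <= c <= 1 -> marginal (gn 0%N) [set u : R | u < c] = c%:E.
  exact: marginal_lt.
have Ple c : 0 <= c <= 1 ->
    marginal (gn 0%N) [set u : R | u <= c \/ 1 < u] = c%:E.
  exact: marginal_le.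
have PE := @marginalE _ _ g0.
have PI := @integral_marginal _ _ g0.
have GK : Gamma (kernel_gamma (marginal (gn 0%N)) mG) by exact: Gamma_kernel.
exists (kernel_gamma (marginal (gn 0%N)) mG); split => //.
  by exists (kernel_nu (marginal (gn 0%N)) mG); exact: disintegration_kernel.
move=> t It psi cpsi.
apply: (@sandwich_cvg _ (tri t) _ _ U PU gn _ t
  (fun q => \int[marginal (gn 0%N)]_(x in `[0, t]) G q x)) => //.
- exact: measurable_tri.
- exact: tri_snd.
- by move=> n; exact: gamma_tri.
- exact: gamma_tri.
- by move=> q _; exact: Gcvg.
- move=> q _; exact: kernel_below_le.
- move=> q r q0 qr; exact: kernel_below_ge.
Qed.

Lemma slab_cvg_unique (R : realType) (gamma gamma' : probability (R * R)%type R)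
    (U : set_system nat) (FU : ProperFilter U) (phi : R * R -> R) :
  Gamma gamma -> Gamma gamma' -> slab_cvg U (fun=> gamma) gamma' ->
  {within triangle, continuous phi} ->
  \int[gamma]_(p in triangle) phi p = \int[gamma']_(p in triangle) phi p.
Proof.
move=> gG g'G gcvg cphi.
have c1 := @slab_cvg_triangle R U _ _ FU (fun=> gG) g'G gcvg _ cphi.
exact: (cvg_unique _ (cvg_cst _) c1).
Qed.

Lemma disintegration_exists (R : realType) (gamma : probability (R * R)%type R) :
  Gamma gamma -> exists nu, disintegration gamma nu.
Proof.
move=> gG; have [U [FU _]] := ultraFilterLemma (eventually_filter).
have [g' [g'G [nu [nu1 nu2 nu3]] gcvg]] := limit_measure FU (fun=> gG).
(* The kernel was built for the limit [g'] of the constant sequence; it also disintegrates [gamma],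
   since both measures integrate continuous functions alike. *)
exists nu; split => // phi cphi; rewrite -nu3// !Rintegral_square//.
apply: (slab_cvg_unique (@ultra_proper _ U FU) gG g'G gcvg).
by apply: continuous_subspaceW cphi => p [].
Qed.

Unset Implicit Arguments.

Theorem theorem3p2 (R : realType) (d : nat) (d_gt0 : (0 < d)%N)
    (x0 : 'rV[R]_d) (f : R -> 'rV[R]_d -> 'rV[R]_d)
    (f_cont : {within I01 `*` [set: 'rV[R]_d],
                continuous (fun p : R * 'rV[R]_d => f p.1 p.2)})
    (k : R) (k_ge0 : 0 <= k)
    (f_lip : forall t, I01 t -> forall x y : 'rV[R]_d,
      norm2 (f t x - f t y) <= k * norm2 (x - y))
    (j : R -> 'rV[R]_d -> R)
    (j_cont : {within I01 `*` [set: 'rV[R]_d],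
                continuous (fun p : R * 'rV[R]_d => j p.1 p.2)})
    (h : 'rV[R]_d -> R) (h_cont : continuous h)
    (g : R -> R -> R)
    (g_cont : {within triangle, continuous (fun p : R * R => g p.1 p.2)}) :
  (forall gamma : probability (R * R)%type R, Gamma gamma ->
    exists theta : nat -> Theta R,
      (fun n => F x0 f j h g (theta n)) @ \oo --> J x0 f j h g gamma) /\
  (exists gamma0 : probability (R * R)%type R,
    [/\ Gamma gamma0,
        forall gamma : probability (R * R)%type R, Gamma gamma ->
          J x0 f j h g gamma0 <= J x0 f j h g gamma &
        (J x0 f j h g gamma0)%:E =
          ereal_inf [set (F x0 f j h g theta)%:E | theta in [set: Theta R]]]).
Proof.
have disint (gamma : probability (R * R)%type R) := @disintegration_exists R gamma.
have Jc U gn gamma (FU : ProperFilter U) :=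
  @J_cvg R d x0 f f_cont k k_ge0 f_lip disint U gn gamma FU.
have approx gamma : Gamma gamma -> exists theta : nat -> Theta R,
    (fun n => F x0 f j h g (theta n)) @ \oo --> J x0 f j h g gamma.
  move=> gG; have [theta ct] := theta_approximation gG; exists theta.
  exact: (Jc _ _ _ _ (fun n => Gamma_delta (theta n)) gG ct).
split; first exact: approx.
pose S := [set (F x0 f j h g theta)%:E | theta in [set: Theta R]].
have id_le : {ae @lebesgue_measure R, forall t : R, I01 t -> t <= t}.
  by apply: aeW => t _.
(* The identity shows that the infimum is over a non-empty set, so a minimizing sequence exists. *)
pose theta0 : Theta R := MkTheta (@measurable_id _ _ _) (fun t (h : I01 t) => h) id_le.
have S0 : S !=set0 by exists (F x0 f j h g theta0)%:E; exists theta0.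
have [u Su cu] := ereal_inf_seq ((set0P _).2 S0).
have /choice[theta thetaE] : forall n, exists th : Theta R, (F x0 f j h g th)%:E = u n.
  by move=> n; have [th _ <-] := Su n; exists th.
(* [U] refines [\oo], so convergence of the costs to the infimum persists along it. *)
have [U [FU sU]] := ultraFilterLemma eventually_filter.
have PU : ProperFilter U := @ultra_proper _ U FU.
have [gamma0 [g0G _ c0]] := limit_measure FU (fun n => Gamma_delta (theta n)).
have JU := Jc _ _ _ PU (fun n => Gamma_delta (theta n)) g0G c0 j h g j_cont h_cont g_cont.
(* The costs of the minimizing sequence have two limits along [U]; their equality also shows that
   the infimum is finite. *)
have JE : (J x0 f j h g gamma0)%:E = ereal_inf S.
  have c1 : u n @[n --> U] --> (J x0 f j h g gamma0)%:E.
    have -> : u = EFin \o (fun n => F x0 f j h g (theta n)).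
      by apply/funext => n /=; rewrite thetaE.
    by apply: cvg_EFin => //; apply: nearW.
  have c2 : u n @[n --> U] --> ereal_inf S.
    by apply: cvg_trans cu; apply: cvg_app.
  exact: (cvg_unique _ c1 c2).
exists gamma0; split => // gamma gG.
(* Minimality over all of [Gamma] comes from density: the infimum bounds each F (th n), whose limit
   is the cost of [gamma]. *)
have [th cth] := approx gamma gG.
apply: (@le_cvg_filter R \oo _ (fun=> J x0 f j h g gamma0) (fun n => F x0 f j h g (th n))) => //.
  exact: cvg_cst.
move=> n; rewrite -lee_fin JE; apply: ereal_inf_lbound.
by exists (th n).
Qed.
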